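(* Let $J(\gamma,s)\ge 0$ ($\gamma>0$, $s\in\mathcal{S}$) be the per-channel achievable rate function and $S_1,S_2,\ldots$ the i.i.d. channel states of the wideband system described in the context. Suppose that: (i) for every $s\in\mathcal{S}$, the function $\gamma\mapsto J(\gamma,s)/\gamma$ is nonnegative and monotonically non-increasing in $\gamma>0$, and the limit $\dot{J}(0,s):=\lim_{\gamma\downarrow 0}\frac{1}{\gamma}J(\gamma,s)$ exists as an extended number in $[0,\infty]$; (ii) the random variable $\dot{J}(0,S_1)$ has logarithmic moment generating function $$\Lambda(\lambda):=\log\mathbf{E}\left[\exp(\lambda\dot{J}(0,S_1))\right]$$ which is an essentially smooth and lower semi-continuous function of $\lambda\in\mathbb{R}$. Let $\bar{\eta}:=1/\mathbf{E}[\dot{J}(0,S_1)]$. Then $\bar\eta$ is the wideband minimum energy per nat of the system, and for every $\eta\ge\bar{\eta}$ the wideband outage exponent is $$\mathcal{E}(\eta)=\sup_{\lambda\le 0}\left\{\frac{\lambda}{\eta}-\Lambda(\lambda)\right\}.$$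
   Context: Setting. There are $K$ parallel channels, whose states $S_1,\ldots,S_K$ are i.i.d. random elements of a measurable space $\mathcal{S}$ with a common distribution not depending on $K$. $J(\gamma,s)$ denotes the mutual information (in nats) between input and output of one channel when the input has average cost $\gamma$ and the channel state is $s$; it is a given nonnegative function, measurable in $s$. A total average cost $\rho>0$ is split uniformly among the channels, so the total achievable rate is the random variable $$R(K,\rho)=\sum_{k=1}^K J(\rho/K,S_k).$$ For a target rate $r\ge 0$ the outage probability is $\mathcal{O}(K,\rho,r)=\Pr[R(K,\rho)\le r]$. The cost (energy) per nat is $\eta=\rho/r$, and the wideband outage exponent is $$\mathcal{E}(\eta):=\lim_{K\to\infty}\frac{-\log\mathcal{O}(K,\rho,r)}{K},\qquad r=\rho/\eta$$ (with $-\log 0=\infty$). The wideband minimum energy per nat is the deterministic limit in probability of $\rho/R(K,\rho)$ as $K\to\infty$. A convex function $\Lambda:\mathbb{R}\to(-\infty,\infty]$ with effective domain $D=\{\lambda:\Lambda(\lambda)<\infty\}$ is essentially smooth if the interior of $D$ is nonempty, $\Lambda$ is differentiable on the interior of $D$, and $|\Lambda'(\lambda_n)|\to\infty$ whenever $(\lambda_n)$ is a sequence in the interior of $D$ converging to a boundary point of $D$. All logarithms are natural. *)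

(* Defs.v *)
From HB Require Import structures.
From mathcomp Require Import all_boot all_order all_algebra.
From mathcomp Require Import all_classical all_reals all_analysis.

Set Implicit Arguments.
Unset Strict Implicit.
Unset Printing Implicit Defensive.

Import Order.TTheory GRing.Theory Num.Theory.
Import numFieldNormedType.Exports.

Local Open Scope classical_set_scope.
Local Open Scope ring_scope.

Section extended_convex_functions.
Context {R : realType}.
Implicit Types f : R -> \bar R.

Definition effective_domain f : set R := [set x | (f x < +oo)%E].

Definition convex_ereal f : Prop :=
  forall x y t : R, 0 <= t <= 1 ->
    (f (t * x + (1 - t) * y)%R <= t%:E * f x + (1 - t)%:E * f y)%E.

(* On the interior of the effective domain a function with values in ]-oo, +oo]
   is finite, so that [fine \o f] is its real-valued version there. *)
Definition essentially_smooth f : Prop :=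
  [/\ forall x, (-oo < f x)%E,
      convex_ereal f,
      (effective_domain f)° !=set0,
      (forall x, (effective_domain f)° x -> derivable (fine \o f) x 1) &
      forall (u : nat -> R) (b : R),
        (forall n, (effective_domain f)° (u n)) ->
        (closure (effective_domain f) `\` (effective_domain f)°) b ->
        u n @[n --> \oo] --> b ->
        `|derive1 (fine \o f) (u n)| @[n --> \oo] --> +oo].

End extended_convex_functions.

Section probability_notions.
Context {d d' : measure_display} {Omega : measurableType d}
  {T : measurableType d'} {R : realType} (P : probability Omega R).

Definition mutually_independent (X : nat -> {RV P >-> T}) : Prop :=
  forall (I : seq nat) (A : nat -> set T),
    uniq I -> (forall k, measurable (A k)) ->
    P (\bigcap_(k in [set` I]) (X k @^-1` A k)) =
      (\prod_(k <- I) P (X k @^-1` A k))%E.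

Definition iid (X : nat -> {RV P >-> T}) : Prop :=
  mutually_independent X /\
  forall k (A : set T), measurable A ->
    distribution P (X k) A = distribution P (X 0) A.

(* The open sets range over the order topology of [-oo, +oo]: for a finite [l]
   this is P(|Y_K - l| >= e) --> 0 for all e > 0, and for [l = +oo] it is
   P(Y_K <= M) --> 0 for all M. *)
Definition cvg_in_probability (Y : nat -> Omega -> \bar R) (l : \bar R) : Prop :=
  forall U : set (\bar R), open U -> U l ->
    P [set w | ~ U (Y K w)] @[K --> \oo] --> 0%E.

(* [expeR -oo = 0], [0 * +oo = 0], [lne 0 = -oo] and [lne +oo = +oo]. *)
Definition log_mgf (Y : Omega -> \bar R) (l : R) : \bar R :=
  lne (\int[P]_w expeR (l%:E * Y w))%E.

End probability_notions.

Section wideband.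
Context {d d' : measure_display} {Omega : measurableType d}
  {T : measurableType d'} {R : realType} (P : probability Omega R).
Variables (J : R -> T -> R) (S : nat -> {RV P >-> T}).

Definition slope0 (s : T) : \bar R := lim ((J g s / g)%:E @[g --> 0^'+]).

(* The states S_1, S_2, ... are indexed from 0. *)
Definition rate (K : nat) (rho : R) (w : Omega) : R :=
  \sum_(k < K) J (rho / K%:R) (S k w).

Definition outage (K : nat) (rho : R) (r : \bar R) : \bar R :=
  P [set w | ((rate K rho w)%:E <= r)%E].

(* The cost per nat [eta] ranges over [0, +oo] with 1 / 0 = +oo and
   1 / +oo = 0; [eta = +oo] corresponds to the target rate 0. *)
Definition is_wideband_outage_exponent (rho : R) (eta e : \bar R) : Prop :=
  (- lne (outage K rho (rho%:E / eta)) * (K%:R^-1)%:E)%E @[K --> \oo] --> e.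

(* rho / R(K, rho) is +oo where R(K, rho) = 0. *)
Definition is_wideband_min_energy_per_nat (rho : R) (eta : \bar R) : Prop :=
  cvg_in_probability P (fun K w => (rho%:E / (rate K rho w)%:E)%E) eta.

End wideband.

(* Main.v *)
(** The J(rho/K, s) K/rho increase with K to the slope X(s) of J at 0, so that
    R(K, rho) is at most rho times the empirical mean of the X(S_k), and a
    Chernoff bound for the sum of the chords converges to the one for X.  The
    outage exponent is therefore sandwiched between the Chernoff exponent of X
    and the exponent of the event that the sum of K copies of X is at most K x,
    where x = 1/eta <= E X.  The latter is bounded below without changing the
    measure: if l minimizes Lambda(l) - l x' with x' slightly below x, then in
    E exp(l (X_1 + .. + X_K)) the parts where the sum is above K x or below K a
    (a < x') are exponentially negligible, because Lambda'(l) = x' lies strictly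
    between a and x.

    For the minimum energy per nat the lower tail of R(K, rho) is again a
    Chernoff bound, and the upper tail follows from the lower one together with
    E R(K, rho) <= rho E X. *)

(* All tilting parameters stay [<= 0]. Since slopes are nonnegative, [exp(l X)] then lies in [0, 1]:
   its expectation is a real number even when X has infinite mean, and dominated convergence by the
   constant 1 passes from chords to slopes.

   The tilted mean is taken strictly below x because for x = E X the minimizer would be the endpoint
   0, where neither a two-sided derivative nor an upward perturbation of the parameter is available.
   The minimum must also not escape to [l = -oo]. Mass of X strictly below x prevents this; when
   there is none, X is almost surely at least x and the event that all summands equal x is used
   instead.

   A priori X may be infinite with positive probability. Lower semicontinuity of Lambda at 0
   excludes this, and it also gives the left continuity at 0 on which minimization over a closed
   interval relies. *)
Require Import Defs.
From HB Require Import structures.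
From mathcomp Require Import all_boot all_order all_algebra.
From mathcomp Require Import all_classical all_reals all_analysis.
From mathcomp Require Import measurable_realfun.
From mathcomp Require Import ring lra.

Import Order.TTheory GRing.Theory Num.Theory.
Import numFieldNormedType.Exports.

Local Open Scope classical_set_scope.
Local Open Scope ring_scope.

Set Implicit Arguments.
Unset Strict Implicit.
Unset Printing Implicit Defensive.

(** * Expectations of products of independent factors *)

Section integral_weighted_comp.
Context {d d' : measure_display} {X : measurableType d} {Y : measurableType d'}
  {R : realType} (mu : {measure set X -> \bar R}).
Variables (W : X -> R) (phi : X -> Y) (c : R).
Hypotheses (mW : measurable_fun setT W) (W0 : forall x, 0 <= W x).
Hypotheses (mphi : measurable_fun setT phi) (c0 : 0 <= c).
Hypothesis WB : forall B, measurable B ->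
  (\int[mu]_x (W x * \1_B (phi x))%:E = c%:E * mu (phi @^-1` B))%E.

Import HBNNSimple.

Let mpre (B : set Y) : measurable B -> measurable (phi @^-1` B).
Proof. by move=> mB; rewrite -[_ @^-1` _]setTI; exact: mphi. Qed.

Let integral_weighted_nnsfun (h : {nnsfun Y >-> R}) :
  (\int[mu]_x (W x * h (phi x))%:E = c%:E * \int[mu]_x (h (phi x))%:E)%E.
Proof.
have mh y : measurable (h @^-1` [set y]) by [].
have mi (B : set Y) : measurable B -> measurable_fun setT (fun x => \1_B (phi x) : R).
  by move=> mB; apply: (measurableT_comp _ mphi); exact/measurable_indicP.
have L : (\int[mu]_x (W x * h (phi x))%:E =
  \sum_(y \in range h) (y%:E * (c%:E * mu (phi @^-1` (h @^-1` [set y])))))%E.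
  transitivity (\int[mu]_x (\sum_(y \in range h)
      (y * (W x * \1_(h @^-1` [set y]) (phi x)))%:E))%E.
    apply: eq_integral => x _; rewrite fsumEFin//; congr EFin.
    rewrite {1}fimfunE mulr_fsumr.
    by apply: eq_fsbigr => y _; rewrite mulrCA.
  rewrite ge0_integral_fsum//; last 2 first.
  - move=> y; apply/measurable_EFinP; apply: measurable_funM => //.
    by apply: measurable_funM => //; exact: mi.
  - move=> y x _; rewrite lee_fin mulrCA mulr_ge0//.
    exact: nnfun_muleindic_ge0.
  apply: eq_fsbigr => y; rewrite inE => -[z _ <-].
  rewrite -(WB (mh _)) -ge0_integralZl_EFin//.
  - by move=> x _; rewrite lee_fin mulr_ge0.
  - by apply/measurable_EFinP; apply: measurable_funM => //; exact: mi.
have L2 : (\int[mu]_x (h (phi x))%:E =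
  \sum_(y \in range h) (y%:E * mu (phi @^-1` (h @^-1` [set y]))))%E.
  transitivity (\int[mu]_x (\sum_(y \in range h)
      (y * (\1_(h @^-1` [set y]) (phi x)))%:E))%E.
    by apply: eq_integral => x _; rewrite fsumEFin//; congr EFin; rewrite {1}fimfunE.
  rewrite ge0_integral_fsum//; last 2 first.
  - move=> y; apply/measurable_EFinP; apply: measurable_funM => //.
    exact: mi.
  - move=> y x _; exact: nnfun_muleindic_ge0.
  apply: eq_fsbigr => y; rewrite inE => -[z _ <-].
  under eq_integral do rewrite EFinM.
  rewrite ge0_integralZl_EFin//.
    by rewrite -[X in mu X]setIT -integral_indic//; exact: mpre.
  by apply/measurable_EFinP; exact: mi.
rewrite L L2 ge0_mule_fsumr//.
  by apply: eq_fsbigr => y _; rewrite muleCA.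
move=> y; have [y0|y0] := leP 0 y; first by rewrite mule_ge0.
by rewrite preimage_nnfun0// preimage_set0 measure0 mule0.
Qed.

(** This upgrades one factor of a product from indicators to nonnegative functions: [W] stands for
    the other factors, [phi] for the state, and [WB] is the product rule tested on events. The
    identity is linear, hence holds for simple functions, and monotone convergence does the rest. *)
Lemma integral_weighted_comp (u : Y -> R) : measurable_fun setT u ->
  (forall y, 0 <= u y) ->
  (\int[mu]_x (W x * u (phi x))%:E = c%:E * \int[mu]_x (u (phi x))%:E)%E.
Proof.
move=> mu_ u0.
have meu : measurable_fun setT (EFin \o u) by exact/measurable_EFinP.
pose h := nnsfun_approx measurableT meu.
have cvgh y : (h n y)%:E @[n --> \oo] --> (u y)%:E.
  by apply: (cvg_nnsfun_approx measurableT meu) => // z _; rewrite lee_fin.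
have ndh y : {homo (fun n => h n y) : m n / (m <= n)%N >-> m <= n}.
  by move=> m n mn; exact/lefP/nd_nnsfun_approx.
have mh n : measurable_fun setT (fun x => h n (phi x)).
  exact: measurableT_comp.
have A : (\int[mu]_x (W x * h n (phi x))%:E)%E @[n --> \oo] -->
    (\int[mu]_x (W x * u (phi x))%:E)%E.
  rewrite (_ : (\int[mu]_x (W x * u (phi x))%:E)%E =
     (\int[mu]_x limn (fun n => (W x * h n (phi x))%:E))%E); last first.
    apply: eq_integral => x _; apply/esym/cvg_lim => //.
    rewrite EFinM; under eq_cvg do rewrite EFinM.
    have := @cvgeZl _ _ _ _ _ (W x)%:E erefl (cvgh (phi x)).
    by apply.
  apply: (@cvg_monotone_convergence _ _ _ mu _ measurableT
    (fun n x => (W x * h n (phi x))%:E)) => //.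
  - by move=> n; apply/measurable_EFinP; exact: measurable_funM.
  - by move=> n x _; rewrite lee_fin mulr_ge0.
  - by move=> x _ m n mn; rewrite lee_fin ler_wpM2l// ndh.
have B : (\int[mu]_x (h n (phi x))%:E)%E @[n --> \oo] -->
    (\int[mu]_x (u (phi x))%:E)%E.
  rewrite (_ : (\int[mu]_x (u (phi x))%:E)%E =
     (\int[mu]_x limn (fun n => (h n (phi x))%:E))%E); last first.
    by apply: eq_integral => x _; exact/esym/cvg_lim.
  apply: (@cvg_monotone_convergence _ _ _ mu _ measurableT
    (fun n x => (h n (phi x))%:E)) => //.
  - by move=> n; exact/measurable_EFinP.
  - by move=> n x _; rewrite lee_fin.
  - by move=> x _ m n mn; rewrite lee_fin ndh.
have C : (\int[mu]_x (W x * h n (phi x))%:E)%E @[n --> \oo] -->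
    (c%:E * \int[mu]_x (u (phi x))%:E)%E.
  by under eq_cvg do rewrite integral_weighted_nnsfun; exact: (cvgeZl _ B).
exact: (cvg_unique _ A C).
Qed.

End integral_weighted_comp.

Section independence.
Context {d d' : measure_display} {Omega : measurableType d}
  {T : measurableType d'} {R : realType} (P : probability Omega R).
Variable S : nat -> {RV P >-> T}.

(* Applied to [0, 1]-valued functions only: [fine] sends an infinite integral
   to 0. *)
Definition expect (f : Omega -> R) : R := fine (\int[P]_w (f w)%:E)%E.

Lemma expectE (f : Omega -> R) : measurable_fun setT f ->
  (forall w, 0 <= f w <= 1) -> (\int[P]_w (f w)%:E = (expect f)%:E)%E.
Proof.
move=> mf f01; rewrite /expect fineK// ge0_fin_numE; last first.
  by apply: integral_ge0 => w _; rewrite lee_fin; case/andP: (f01 w).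
apply: (@le_lt_trans _ _ (\int[P]_w (cst 1%E w))%E).
  apply: ge0_le_integral => //.
  - by move=> w _; rewrite lee_fin; case/andP: (f01 w).
  - exact/measurable_EFinP.
  - by move=> w _; rewrite lee_fin; case/andP: (f01 w).
rewrite integral_cst// mul1e.
exact: le_lt_trans (probability_le1 P measurableT) (ltry _).
Qed.

Lemma expect_ge0 (f : Omega -> R) : (forall w, 0 <= f w) -> 0 <= expect f.
Proof. by move=> f0; apply: fine_ge0; apply: integral_ge0 => w _; rewrite lee_fin. Qed.

Lemma measurable_RV_comp (h : T -> R) k : measurable_fun setT h ->
  measurable_fun setT (fun w => h (S k w)).
Proof. by move=> mh; apply: measurableT_comp. Qed.

Let unit_fun (h : T -> R) := measurable_fun setT h /\ forall t, 0 <= h t <= 1.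

Let unit_indic (A : set T) : measurable A -> unit_fun \1_A.
Proof.
move=> mA; split; first exact/measurable_indicP.
by move=> t; rewrite indicE ler0n lern1 leq_b1.
Qed.

Lemma expect_prod (indS : mutually_independent S) (n : nat) (h : nat -> T -> R) :
  (forall k, measurable_fun setT (h k)) -> (forall k t, 0 <= h k t <= 1) ->
  (\int[P]_w (\prod_(k < n) h k (S k w))%:E =
   (\prod_(k < n) expect (fun w => h k (S k w)))%:E)%E.
Proof.
move=> mh h01.
have {mh h01} uh k : unit_fun (h k) by [].
(* The first j factors are arbitrary, the remaining ones indicators: the
   product rule for events is the case j = 0. *)
suff: forall j (h : nat -> T -> R), (forall k, unit_fun (h k)) ->
    (forall k, (j <= k)%N -> exists2 A, measurable A & h k = \1_A) ->
  (\int[P]_w (\prod_(k < n) h k (S k w))%:E =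
   (\prod_(k < n) expect (fun w => h k (S k w)))%:E)%E.
  (* Factors of index at least [n] do not occur in the product. Replacing them by the indicator of
     the whole space makes the claim for [j = n] applicable. *)
  pose h' k := if (k < n)%N then h k else \1_setT.
  move=> /(_ n h') H.
  have h'E (k : 'I_n) : h' k = h k by rewrite /h' ltn_ord.
  under eq_integral do under eq_bigr do rewrite -h'E.
  under [in RHS]eq_bigr do rewrite -h'E.
  apply: H => k; first by rewrite /h'; case: ifP => // _; exact: unit_indic.
  by move=> nk; exists setT; rewrite // /h' ltnNge nk.
move=> {uh} {}j; elim: j => [|j IH] {}h uh hj.
  have /choice [A hA] : forall k, exists A, measurable A /\ h k = \1_A.
    by move=> k; have [//|A mA hA] := hj k; exists A.
  have mSA k : measurable (S k @^-1` A k).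
    by rewrite -[_ @^-1` _]setTI; apply: (measurable_funP (S k)) => //; case: (hA k).
  transitivity (\int[P]_w (\1_(\bigcap_(k in [set` iota 0 n]) (S k @^-1` A k)) w)%:E)%E.
    apply: eq_integral => w _; congr EFin.
    rewrite indicE; case: (boolP (w \in _)) => wA.
      rewrite big1// => k _; rewrite (hA k).2 indicE.
      rewrite inE in wA; rewrite mem_set//; apply: (wA k) => /=.
      by rewrite mem_iota /= ltn_ord.
    have [k kn Hk] : exists2 k : 'I_n, true & S k w \notin A k.
      apply: contrapT => Hn; move/negP: wA; apply; rewrite inE => k /=.
      rewrite mem_iota /= add0n => kn.
      apply: contrapT => wk; apply: Hn; exists (Ordinal kn) => //=.
      by rewrite notin_setE.
    by rewrite (bigD1 k)//= (hA k).2 indicE (negbTE Hk) mul0r.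
  rewrite integral_indic//; last first.
    by apply: fin_bigcap_measurable => //; exact: finite_set.
  transitivity (\prod_(k <- iota 0 n) P (S k @^-1` A k))%E.
    rewrite setIT; apply: indS; first exact: iota_uniq.
    by move=> k; case: (hA k).
  rewrite -{1}[n]subn0 -/(index_iota 0 n) big_mkord -prodEFin.
  apply: eq_bigr => k _; rewrite -expectE.
  - transitivity (\int[P]_w (\1_(S k @^-1` A k) w)%:E)%E.
      by rewrite integral_indic// setIT.
    by apply: eq_integral => w _; rewrite (hA k).2.
  - by apply: measurable_RV_comp; case: (uh k).
  - by move=> w; case: (uh k) => _; exact.
have [jn|nj] := ltnP j n; last first.
  pose h' k := if (k < n)%N then h k else \1_setT.
  have h'E (k : 'I_n) : h' k = h k by rewrite /h' ltn_ord.
  under eq_integral do under eq_bigr do rewrite -h'E.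
  under [in RHS]eq_bigr do rewrite -h'E.
  apply: IH => k; first by rewrite /h'; case: ifP => // _; exact: unit_indic.
  move=> jk; exists setT => //; rewrite /h' ltnNge.
  by rewrite (leq_trans nj jk).
pose j' := Ordinal jn.
pose W w := \prod_(k < n | k != j') h k (S k w).
pose c := \prod_(k < n | k != j') expect (fun w => h k (S k w)).
have h0 k t : 0 <= h k t by case/andP: ((uh k).2 t).
have mhS k : measurable_fun setT (fun w => h k (S k w)).
  by apply: measurable_RV_comp; case: (uh k).
have c0 : 0 <= c by apply: prodr_ge0 => k _; exact: expect_ge0.
have mW : measurable_fun setT W.
  rewrite /W; under eq_fun do rewrite big_mkcond /=.
  by apply: measurable_prod => k _; case: (k != j').
transitivity (\int[P]_w (W w * h j (S j w))%:E)%E.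
  apply: eq_integral => w _; congr EFin.
  by rewrite [LHS](bigD1 j')//= mulrC.
rewrite (@integral_weighted_comp _ _ _ _ _ P W (S j) c)//.
- rewrite expectE//; last by move=> w; exact: (uh j).2.
  by rewrite -EFinM; congr EFin; rewrite [RHS](bigD1 j')//= mulrC.
- by move=> w; apply: prodr_ge0.
(* The weighted identity for events is the induction hypothesis, applied with factor [j] replaced by
   an indicator. *)
- move=> B mB; pose h' k := if k == j then \1_B else h k.
  have h'E (k : 'I_n) : k != j' -> h' k = h k.
    by rewrite /h' -val_eqE /= => /negbTE ->.
  have h'j : h' j = \1_B by rewrite /h' eqxx.
  have uh' k : unit_fun (h' k).
    by rewrite /h'; case: ifP => // _; exact: unit_indic.
  transitivity (\int[P]_w (\prod_(k < n) h' k (S k w))%:E)%E.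
    apply: eq_integral => w _; congr EFin; rewrite [RHS](bigD1 j')//= h'j mulrC.
    by congr (_ * _); apply: eq_bigr => k kj; rewrite h'E.
  rewrite IH//; last first.
    move=> k jk; rewrite /h'; case: eqP => [_|/eqP kj]; first by exists B.
    by apply: hj; rewrite ltn_neqAle eq_sym kj.
  rewrite [in LHS](bigD1 j')//= h'j mulrC EFinM; congr (_ * _)%E.
    by congr EFin; apply: eq_bigr => k kj; rewrite h'E.
  rewrite -expectE.
  - transitivity (\int[P]_w (\1_(S j @^-1` B) w)%:E)%E.
      by apply: eq_integral.
    rewrite integral_indic// ?setIT//.
    by rewrite -[_ @^-1` _]setTI; apply: (measurable_funP (S j)).
  - exact/measurable_RV_comp/measurable_indicP.
  - by move=> w; have [_] := unit_indic mB; exact.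
- by case: (uh j).
Qed.

Lemma iid_integral (iidS : iid S) (k : nat) (f : T -> \bar R) :
  measurable_fun setT f -> (forall t, 0 <= f t)%E ->
  (\int[P]_w f (S k w) = \int[P]_w f (S 0 w))%E.
Proof.
move=> mf f0.
rewrite -(ge0_integral_distribution (S k) mf f0).
rewrite -(ge0_integral_distribution (S 0) mf f0).
by apply: eq_measure_integral => A mA _; exact: iidS.2.
Qed.

Lemma expect_iid_prod (iidS : iid S) (n : nat) (h : T -> R) :
  measurable_fun setT h -> (forall t, 0 <= h t <= 1) ->
  (\int[P]_w (\prod_(k < n) h (S k w))%:E =
   (expect (fun w => h (S 0 w)) ^+ n)%:E)%E.
Proof.
move=> mh h01; rewrite (@expect_prod iidS.1 n (fun=> h))//.
rewrite (eq_bigr (fun=> expect (fun w => h (S 0 w)))).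
  by rewrite big_const_ord iter_mulr_1.
move=> k _; rewrite /expect (@iid_integral iidS k (EFin \o h))//.
- exact/measurable_EFinP.
- by move=> t; rewrite lee_fin; case/andP: (h01 t).
Qed.

End independence.

(** * Exponential bounds for i.i.d. sums *)

Section large_deviation_bounds.
Context {d d' : measure_display} {Omega : measurableType d}
  {T : measurableType d'} {R : realType} (P : probability Omega R).
Variables (S : nat -> {RV P >-> T}) (iidS : iid S).
Variables (u : T -> R) (u_meas : measurable_fun setT u) (u0 : forall t, 0 <= u t).

Definition sum_states (n : nat) (w : Omega) : R := \sum_(k < n) u (S k w).

(** Meant for [l <= 0], where the integrand lies in [0, 1] and [expect] is the true expectation. *)
Definition mgf (l : R) : R := expect P (fun w => expR (l * u (S 0 w))).

Lemma measurable_sum_states n : measurable_fun setT (sum_states n).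
Proof. apply: measurable_sum => k. exact: (measurable_RV_comp S k u_meas). Qed.

Lemma expR_mulNneg_unit (l y : R) : l <= 0 -> 0 <= y -> 0 <= expR (l * y) <= 1.
Proof. by move=> l0 y0; rewrite expR_ge0 -expR0 ler_expR mulr_le0_ge0. Qed.

Lemma measurable_expRM d1 (X : measurableType d1) (f : X -> R) l :
  measurable_fun setT f -> measurable_fun setT (fun x => expR (l * f x)).
Proof.
move=> mf; apply: measurableT_comp; first exact: measurable_expR.
by apply: measurable_funM.
Qed.

Lemma measurable_expR_sum_states n l :
  measurable_fun setT (fun w => (expR (l * sum_states n w))%:E).
Proof.
apply/measurable_EFinP.
by have := measurable_expRM l (@measurable_sum_states n); apply.
Qed.

Lemma integral_expR_sum_states n l : l <= 0 ->
  (\int[P]_w (expR (l * sum_states n w))%:E = (mgf l ^+ n)%:E)%E.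
Proof.
move=> l0.
rewrite -(expect_iid_prod iidS n (measurable_expRM l u_meas)); last first.
  by move=> t; exact: expR_mulNneg_unit.
by apply: eq_integral => w _; rewrite -expR_sum mulr_sumr.
Qed.

Lemma mgfE l : l <= 0 -> (\int[P]_w (expR (l * u (S 0 w)))%:E = (mgf l)%:E)%E.
Proof.
move=> l0; rewrite -[mgf l]expr1 -integral_expR_sum_states//.
by apply: eq_integral => w _; rewrite /sum_states big_ord1.
Qed.

Lemma mgf_ge0 l : 0 <= mgf l.
Proof. by apply: expect_ge0 => w; exact: expR_ge0. Qed.

Lemma measurable_sum_le n x : measurable [set w | sum_states n w <= x].
Proof.
rewrite -[X in measurable X]setTI (_ : [set w | _] = sum_states n @^-1` `]-oo, x]).
  exact: measurable_sum_states.
by apply/seteqP; split => w /=; rewrite in_itv.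
Qed.

(** Markov's inequality for [exp(l s)], which is at least [exp(l n x)] on the event because
    [l <= 0]. *)
Lemma chernoff_lower n l x : l <= 0 ->
  (P [set w | (sum_states n w <= n%:R * x)%R]
     <= ((expR (- (l * x)) * mgf l) ^+ n)%:E)%E.
Proof.
move=> l0; set A := [set w | _].
have mA : measurable A by exact: measurable_sum_le.
have H : (\int[P]_w (expR (l * (n%:R * x)) * \1_A w)%:E <=
  \int[P]_w (expR (l * sum_states n w))%:E)%E.
  apply: ge0_le_integral => //.
  - by apply/measurable_EFinP; apply: measurable_funM.
  - exact: measurable_expR_sum_states.
  - move=> w _; rewrite lee_fin indicE; case: (boolP (w \in A)) => wA.
      by rewrite mulr1 ler_expR ler_wnM2l//; rewrite inE in wA.
    by rewrite mulr0 expR_ge0.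
move: H; rewrite integral_expR_sum_states//.
under eq_integral do rewrite EFinM.
rewrite ge0_integralZl_EFin ?expR_ge0//; last first.
  exact/measurable_EFinP/measurable_indicP.
have -> : (\int[P]_w (\1_A w)%:E = (fine (P A))%:E)%E.
  by rewrite integral_indic// setIT fineK// fin_num_measure.
have -> : P A = (fine (P A))%:E by rewrite fineK// fin_num_measure.
rewrite -EFinM !lee_fin exprMn -expRM_natl => H.
have E1 : expR (n%:R * - (l * x)) * expR (l * (n%:R * x)) = 1.
  by rewrite -expRD (_ : _ + _ = 0) ?expR0//; ring.
by have := ler_wpM2l (expR_ge0 (n%:R * - (l * x))) H; rewrite mulrA E1 mul1r.
Qed.

(* E exp(l s) is split according to s < n a, n a <= s <= n b and n b < s; the two
   outer parts are bounded by Chernoff at l - t' and l + t. *)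
Lemma tilted_lower_bound n l a b t t' : l <= 0 -> 0 <= t -> l + t <= 0 -> 0 <= t' ->
  ((expR (- (l * a)) ^+ n * (mgf l ^+ n - (expR (- (t * b)) * mgf (l + t)) ^+ n
     - (expR (t' * a) * mgf (l - t')) ^+ n))%:E
   <= P [set w | (sum_states n w <= n%:R * b)%R])%E.
Proof.
move=> l0 t0 lt0 t'0; set A := [set w | _].
have mA : measurable A by exact: measurable_sum_le.
have lt'0 : l - t' <= 0 by lra.
have mE k : measurable_fun setT (fun w => (expR (k * sum_states n w))%:E).
  exact: measurable_expR_sum_states.
have E0 k w : (0 <= (expR (k * sum_states n w))%:E)%E by rewrite lee_fin expR_ge0.
have H : (\int[P]_w (expR (l * sum_states n w))%:E <=
  \int[P]_w ((expR (l * (n%:R * a)))%:E * (\1_A w)%:E +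
     ((expR (- (t * (n%:R * b))))%:E * (expR ((l + t) * sum_states n w))%:E +
      (expR (t' * (n%:R * a)))%:E * (expR ((l - t') * sum_states n w))%:E)))%E.
  apply: ge0_le_integral => //.
  - apply: emeasurable_funD.
      apply: emeasurable_funM => //.
      exact/measurable_EFinP/measurable_indicP.
    by apply: emeasurable_funD; apply: emeasurable_funM => //; exact: mE.
  - move=> w _; rewrite -!EFinM -!EFinD lee_fin -!expRD.
    set s := sum_states n w.
    have p1 : 0 <= expR (- (t * (n%:R * b)) + (l + t) * s) by exact: expR_ge0.
    have p2 : 0 <= expR (t' * (n%:R * a) + (l - t') * s) by exact: expR_ge0.
    rewrite indicE; case: (boolP (w \in A)) => wA; last first.
      have sb : n%:R * b <= s.
        by apply: ltW; rewrite ltNge; apply: contra wA => ?; rewrite inE.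
      rewrite mulr0 add0r -[leLHS]addr0 lerD// ler_expR.
      have : 0 <= t * (s - n%:R * b) by rewrite mulr_ge0// subr_ge0.
      by lra.
    rewrite mulr1; have [sa|sa] := leP (n%:R * a) s.
      rewrite -[leLHS]addr0 lerD ?addr_ge0// ler_expR.
      exact: ler_wnM2l.
    rewrite addrA -[leLHS]add0r lerD ?addr_ge0 ?expR_ge0// ler_expR.
    have : 0 <= t' * (n%:R * a - s) by rewrite mulr_ge0// subr_ge0 ltW.
    by lra.
have mZ (k : R) (f : Omega -> \bar R) : measurable_fun setT f ->
    measurable_fun setT (fun w => k%:E * f w)%E.
  by move=> mf; apply: emeasurable_funM.
have mI : measurable_fun setT (fun w => (\1_A w : R)%:E).
  exact/measurable_EFinP/measurable_indicP.
move: H.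
rewrite ge0_integralD; [|exact: measurableT| | exact: mZ | |
  by apply: emeasurable_funD; exact: mZ]; last 2 first.
- by move=> w _; rewrite -EFinM lee_fin mulr_ge0// expR_ge0.
- by move=> w _; rewrite -!EFinM -EFinD lee_fin addr_ge0// mulr_ge0// expR_ge0.
rewrite ge0_integralD; [|exact: measurableT| | exact: mZ | | exact: mZ]; last 2 first.
- by move=> w _; rewrite -EFinM lee_fin mulr_ge0// expR_ge0.
- by move=> w _; rewrite -EFinM lee_fin mulr_ge0// expR_ge0.
rewrite !ge0_integralZl_EFin ?expR_ge0//.
rewrite !integral_expR_sum_states//.
have -> : (\int[P]_w (\1_A w)%:E = (fine (P A))%:E)%E.
  by rewrite integral_indic// setIT fineK// fin_num_measure.
have -> : P A = (fine (P A))%:E by rewrite fineK// fin_num_measure.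
rewrite -!EFinM -!EFinD !lee_fin !exprMn -!expRM_natl => H.
have E1 : expR (n%:R * - (l * a)) * expR (l * (n%:R * a)) = 1.
  by rewrite -expRD (_ : _ + _ = 0) ?expR0//; ring.
rewrite (_ : n%:R * - (t * b) = - (t * (n%:R * b))); last by ring.
rewrite (_ : n%:R * (t' * a) = t' * (n%:R * a)); last by ring.
have := ler_wpM2l (expR_ge0 (n%:R * - (l * a))) H.
rewrite mulrDr mulrA E1 mul1r.
by lra.
Qed.

(** The three strict inequalities say that both outer parts are geometrically small compared with
    [mgf l ^+ n], and that [exp(- c n)] is geometrically small compared with the resulting main
    term. *)
Lemma tilted_lower_bound_near l a b t t' c :
  l <= 0 -> 0 <= t -> l + t <= 0 -> 0 <= t' -> 0 < mgf l ->
  expR (- (t * b)) * mgf (l + t) < mgf l ->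
  expR (t' * a) * mgf (l - t') < mgf l ->
  expR (- c) < expR (- (l * a)) * mgf l ->
  \forall n \near \oo,
    ((expR (- c) ^+ n)%:E <= P [set w | (sum_states n w <= n%:R * b)%R])%E.
Proof.
move=> l0 t0 lt0 t'0 M0 h1 h2 h3.
have g0 : 0 < expR (- (l * a)) * mgf l by rewrite mulr_gt0// expR_gt0.
(* The threshold 1/3 serves all three ratios at once, since 1 - 1/3 - 1/3 = 1/3. *)
have small (x y : R) : 0 <= x -> 0 < y -> x < y ->
    \forall n \near \oo, (x / y) ^+ n < 3^-1.
  move=> x0 y0 xy.
  have q1 : `|x / y| < 1.
    by rewrite ger0_norm ?divr_ge0// ?(ltW y0)// ltr_pdivrMr// mul1r.
  by apply: (cvgr_lt _ (cvg_expr q1)); rewrite invr_gt0.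
pose g := expR (- (l * a)) * mgf l.
pose p := expR (- (t * b)) * mgf (l + t).
pose q := expR (t' * a) * mgf (l - t').
have p0 : 0 <= p by rewrite mulr_ge0 ?expR_ge0 ?mgf_ge0.
have q0 : 0 <= q by rewrite mulr_ge0 ?expR_ge0 ?mgf_ge0.
have s1 := small _ _ (expR_ge0 (- c)) (g0 : 0 < g) h3.
have s2 := small _ _ p0 M0 h1.
have s3 := small _ _ q0 M0 h2.
near=> n.
apply: le_trans; last first.
  by apply: (@tilted_lower_bound n l a b t t').
rewrite lee_fin -/p -/q.
have -> : expR (- c) ^+ n = g ^+ n * (expR (- c) / g) ^+ n.
  by rewrite -exprMn; congr (_ ^+ _); rewrite mulrC divfK// gt_eqF.
have -> : p ^+ n = mgf l ^+ n * (p / mgf l) ^+ n.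
  by rewrite -exprMn; congr (_ ^+ _); rewrite mulrC divfK// gt_eqF.
have -> : q ^+ n = mgf l ^+ n * (q / mgf l) ^+ n.
  by rewrite -exprMn; congr (_ ^+ _); rewrite mulrC divfK// gt_eqF.
rewrite (_ : _ * (_ - _ - _) = g ^+ n *
   (1 - (p / mgf l) ^+ n - (q / mgf l) ^+ n)); last by rewrite [g ^+ n]exprMn; ring.
apply: ler_wpM2l; first by rewrite exprn_ge0// ltW.
have : (expR (- c) / g) ^+ n < 3^-1 by near: n.
have : (p / mgf l) ^+ n < 3^-1 by near: n.
have : (q / mgf l) ^+ n < 3^-1 by near: n.
by lra.
Unshelve. all: end_near. Qed.

End large_deviation_bounds.

(** * Lower bound in Cramer's theorem *)

Lemma is_derive0_small (R : realType) (f : R -> R) (c e : R) :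
  is_derive c 1 f 0 -> 0 < e ->
  exists2 r, 0 < r & forall h, `|h| < r -> `|f (c + h) - f c| <= e * `|h|.
Proof.
move=> [df Df] e0.
move: df => /cvgrPdist_lt /(_ e e0); rewrite -[lim _]/('D_1 f c) Df.
move=> /nbhs_ballP[r /= r0 H]; exists r => // h hr.
have [->|h0] := eqVneq h 0; first by rewrite addr0 subrr !normr0 mulr0.
have := H h; rewrite /ball /= sub0r normrN => /(_ hr h0).
rewrite sub0r normrN normrM normfV /GRing.scale /= mulr1 (addrC h c) mulrC.
by rewrite ltr_pdivrMr ?normr_gt0// => /ltW.
Qed.

Section cramer.
Context {d d' : measure_display} {Omega : measurableType d}
  {T : measurableType d'} {R : realType} (P : probability Omega R).
Variables (S : nat -> {RV P >-> T}) (iidS : iid S).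
Variables (u : T -> R) (u_meas : measurable_fun setT u) (u0 : forall t, 0 <= u t).
Local Notation M := (mgf S u).

Hypothesis M_gt0 : forall l, l <= 0 -> 0 < M l.
Hypothesis M_cvg1 : M l @[l --> 0^'-] --> (1 : R).
Hypothesis M_derivable : forall l, l < 0 -> derivable (fun l => ln (M l)) l 1.

Lemma mgf0 : M 0 = 1.
Proof.
apply: EFin_inj; rewrite -(mgfE iidS u_meas u0)//.
under eq_integral do rewrite mul0r expR0.
by rewrite integral_cst// mul1e; exact: probability_setT.
Qed.

Lemma measurable_state_le k y : measurable [set w | u (S k w) <= y].
Proof.
rewrite -[X in measurable X]setTI (_ : [set w | _] = (fun w => u (S k w)) @^-1` `]-oo, y]).
  exact: (measurable_RV_comp S k u_meas).
by apply/seteqP; split => w /=; rewrite in_itv.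
Qed.

(** Only the part of the expectation with [u <= y] is kept. The resulting growth as [l] tends to
    [-oo] provides coercivity. *)
Lemma mgf_ge_prob y l : l <= 0 ->
  fine (P [set w | u (S 0 w) <= y]) * expR (l * y) <= M l.
Proof.
move=> l0; set A := [set w | _].
have mA : measurable A by exact: measurable_state_le.
rewrite -lee_fin -(mgfE iidS u_meas u0)// EFinM fineK ?fin_num_measure// muleC.
have -> : (P A = \int[P]_w (\1_A w)%:E)%E by rewrite integral_indic// setIT.
rewrite -ge0_integralZl_EFin ?expR_ge0//; last exact/measurable_EFinP/measurable_indicP.
apply: ge0_le_integral => //.
- by apply: emeasurable_funM => //; exact/measurable_EFinP/measurable_indicP.
- apply/measurable_EFinP.
  by have := measurable_expRM l (measurable_RV_comp S 0 u_meas); apply.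
- move=> w _; rewrite -EFinM lee_fin indicE; case: (boolP (w \in A)) => wA.
    by rewrite mulr1 ler_expR ler_wnM2l//; rewrite inE in wA.
  by rewrite mulr0 expR_ge0.
Qed.

(** The function [f l = ln (M l) - l y] vanishes at 0, is negative at [- t] and positive at [- N],
    so its minimum over [-N, 0] is interior and the derivative of [ln M] there is [y]. Near the
    minimizer [f] varies by o(h), which a linear gain [(b - y) h] or [(y - a) h] dominates. *)
Lemma tilted_mean_exists (x y : R) (N : R) : y < x -> 0 < N ->
  (exists2 t, 0 < t & M (- t) < expR (- (t * y))) ->
  (forall t, N <= t -> expR (- (t * y)) < M (- t)) ->
  exists l, [/\ - N < l, l < 0 & forall a b, a < y -> y < b ->
    exists t t', [/\ 0 <= t, l + t <= 0, 0 <= t',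
      expR (- (t * b)) * M (l + t) < M l &
      expR (t' * a) * M (l - t') < M l]].
Proof.
move=> yx N0 [t t0 Mt] MN.
pose f l := ln (M l) - l * y.
have fE l : l <= 0 -> M l = expR (f l + l * y).
  by move=> l0; rewrite subrK lnK// posrE M_gt0.
have tN : t < N.
  rewrite ltNge; apply/negP => Nt; have := lt_trans Mt (MN t Nt).
  by rewrite ltxx.
have ft : f (- t) < 0.
  rewrite /f subr_lt0 mulNr -[X in _ < X]expRK ltr_ln ?posrE ?expR_gt0//.
  by apply: M_gt0; rewrite oppr_le0 ltW.
have fN : 0 < f (- N).
  rewrite /f subr_gt0 mulNr -[X in X < _]expRK ltr_ln ?posrE ?expR_gt0 ?MN//.
  by apply: M_gt0; rewrite oppr_le0 ltW.
have f0 : f 0 = 0 by rewrite /f mgf0 ln1 mul0r subr0.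
have df l : l < 0 -> derivable f l 1.
  move=> l0; apply: derivableB; first exact: M_derivable.
  by apply: derivableM => //; exact: derivable_id.
have cf l : l < 0 -> {for l, continuous f}.
  by move=> l0; apply: differentiable_continuous; exact/derivable1_diffP/df.
have N0' : - N < 0 by rewrite oppr_lt0.
have cf' : {within `[- N, 0], continuous f}.
  apply/(continuous_within_itvP _ N0'); split.
  - by move=> l; rewrite in_itv /= => /andP[_ l0]; exact: cf.
  - by apply: cvg_at_right_filter; exact: cf.
  (* Differentiability is known only for [l < 0]; at the right end continuity comes from the left
     limit of [M]. *)
  - have c1 : ln (M l) @[l --> 0^'-] --> ln (1 : R).
      by apply: (continuous_cvg _ _ M_cvg1); exact: continuous_ln.
    have c2 : l * y @[l --> 0^'-] --> 0 * y.
      by apply: cvgM; [exact: cvg_at_left_filter|exact: cvg_cst].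
    rewrite (_ : f 0 = ln 1 - 0 * y); last by rewrite f0 ln1 mul0r subr0.
    exact: (cvgB c1 c2).
have [l lN lmin] := EVT_min (ltW N0') cf'.
have flt : f l < 0.
  apply: le_lt_trans ft; apply: lmin.
  by rewrite in_itv /= lerN2 oppr_le0 !ltW.
have [l1 l2] : - N < l /\ l < 0.
  move: lN; rewrite in_itv /= => /andP[l1 l2]; split.
    rewrite lt_neqAle l1 andbT; apply/eqP => E.
    by move: flt; rewrite -E ltNge (ltW fN).
  rewrite lt_neqAle l2 andbT; apply/eqP => E.
  by move: flt; rewrite E f0 ltxx.
exists l; split => // a b ay yb.
have Dl : is_derive l 1 f 0.
  apply: (@derive1_at_min _ f (- N) 0 l (ltW N0')).
  - by move=> s; rewrite in_itv /= => /andP[_ s0]; exact: df.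
  - by rewrite in_itv /= l1.
  - move=> s; rewrite in_itv /= => /andP[s1 s2]; apply: lmin.
    by rewrite in_itv /= !ltW.
(* Half of each gap, so that the error [e h] stays strictly below both [(b - y) h] and
   [(y - a) h]. *)
pose e := Num.min ((b - y) / 2) ((y - a) / 2).
have e0 : 0 < e by rewrite /e lt_min !divr_gt0 ?subr_gt0.
have [r r0 Hr] := is_derive0_small Dl e0.
(* The bound [- l] keeps [l + h <= 0]; the same step [h] serves both directions. *)
pose h := Num.min (r / 2) (- l).
have h0 : 0 < h by rewrite /h lt_min divr_gt0//= oppr_gt0.
have hr : h < r by rewrite /h gt_min; apply/orP; left; rewrite ltr_pdivrMr// ltr_pMr// ltr1n.
have hl : h <= - l by rewrite /h ge_min lexx orbT.
have eb : e <= (b - y) / 2 by rewrite /e ge_min lexx.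
have ea : e <= (y - a) / 2 by rewrite /e ge_min lexx orbT.
have lh : l + h <= 0 by rewrite -lerBrDl sub0r.
have lh' : l - h <= 0 by rewrite subr_le0 (le_trans (ltW l2))// ltW.
exists h, h; split => //; [exact: ltW|exact: ltW| |].
- rewrite !fE ?(ltW l2)// -expRD ltr_expR.
  have := Hr h; rewrite (gtr0_norm h0) hr => /(_ isT).
  rewrite ler_norml => /andP[_ H1].
  have : e * h < (b - y) * h by rewrite ltr_pM2r//; lra.
  by lra.
- rewrite !fE ?(ltW l2)// -expRD ltr_expR.
  have := Hr (- h); rewrite normrN (gtr0_norm h0) hr => /(_ isT).
  rewrite ler_norml => /andP[_ H1].
  have : e * h < (y - a) * h by rewrite ltr_pM2r//; lra.
  by lra.
Qed.

Variable x : R.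
Hypothesis x_le_mean : forall y, y < x -> exists2 t, 0 < t & M (- t) < expR (- (t * y)).

(* Tilting to a mean y slightly below x puts y strictly inside ]x - e, x[; by
   coercivity the tilting parameter stays in ]-N, 0[ with N independent of y. *)
Let cramer_tilt (delta c c' : R) : 0 < delta ->
  P [set w | u (S 0 w) <= x - 2 * delta] != 0%E ->
  (forall l, l <= 0 -> l * x - ln (M l) <= c') -> c' < c ->
  \forall n \near \oo,
    ((expR (- c) ^+ n)%:E <= P [set w | (sum_states S u n w <= n%:R * x)%R])%E.
Proof.
move=> delta0; set A := [set w | _] => PA I c'c.
have mA : measurable A by exact: measurable_state_le.
pose p := fine (P A).
have p0 : 0 < p.
  by rewrite /p fine_gt0// lt0e PA measure_ge0 ltey_eq fin_num_measure.
(* By [mgf_ge_prob], [M (- t)] is at least [p exp(- t (x - 2 delta))]. For [y > x - delta] this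
   exceeds [exp(- t y)] as soon as [ln p + t delta > 0]. *)
pose N := Num.max 1 (1 - ln p / delta).
have N1 : 1 <= N by rewrite /N le_max lexx.
have N0 : 0 < N by exact: lt_le_trans N1.
have HN y : x - delta < y -> forall t, N <= t -> expR (- (t * y)) < M (- t).
  move=> xy t Nt; have t0 : 0 < t by exact: lt_le_trans Nt.
  have t0' : - t <= 0 by rewrite oppr_le0 ltW.
  apply: lt_le_trans (mgf_ge_prob (x - 2 * delta) t0').
  rewrite -/A -/p -[p]lnK ?posrE// -expRD ltr_expR.
  have h1 : 1 - ln p / delta <= t.
    by apply: le_trans Nt; rewrite /N le_max lexx orbT.
  have h2 : 0 < ln p + t * delta.
    have : 0 < (t + ln p / delta) * delta by rewrite mulr_gt0//; lra.
    by rewrite mulrDl divfK ?gt_eqF// addrC.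
  have h3 : 0 < t * (y - (x - delta)) by rewrite mulr_gt0// subr_gt0.
  by lra.
(* Two constraints: [e < delta] keeps [y = x - e / 2] above [x - delta], and [N e < c - c'] pays for
   evaluating the exponent at [a = x - e] instead of [x], which costs [- l e < N e]. *)
pose e := Num.min delta ((c - c') / N) / 2.
have e0 : 0 < e by rewrite divr_gt0// lt_min delta0 divr_gt0// subr_gt0.
have ed : e < delta.
  have : Num.min delta ((c - c') / N) <= delta by rewrite ge_min lexx.
  by rewrite /e; lra.
have eN : N * e < c - c'.
  have : Num.min delta ((c - c') / N) <= (c - c') / N by rewrite ge_min lexx orbT.
  rewrite ler_pdivlMr// => h; have : 0 < c - c' by rewrite subr_gt0.
  by rewrite /e; lra.
pose y := x - e / 2.
have yx : y < x by rewrite /y; lra.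
have [|l [l1 l2 Hl]] := tilted_mean_exists yx N0 (x_le_mean yx).
  by apply: HN; rewrite /y; lra.
have [||t [t' [ta tb tc td te]]] := Hl (x - e) x => //.
  by rewrite /y; lra.
apply: (@tilted_lower_bound_near _ _ _ _ _ P S iidS u u_meas u0 l (x - e) x t t' c) => //.
- exact: ltW.
- by apply: M_gt0; exact: ltW.
- rewrite -[M l]lnK ?posrE ?M_gt0 ?(ltW l2)// -expRD ltr_expR.
  have := I l (ltW l2).
  have : - (l * e) < N * e by rewrite -mulNr ltr_pM2r// ltrNl.
  by lra.
Qed.

(* Here u >= x almost surely, and the bound comes from all the terms being
   equal to x: the infimum of E exp(l (u - x)) is its limit as l --> -oo. *)
Let cramer_edge (c c' : R) :
  (forall delta, 0 < delta -> P [set w | u (S 0 w) <= x - delta] = 0%E) ->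
  (forall l, l <= 0 -> l * x - ln (M l) <= c') -> c' < c ->
  forall n,
    ((expR (- c) ^+ n)%:E <= P [set w | (sum_states S u n w <= n%:R * x)%R])%E.
Proof.
move=> H0 I c'c n.
set A := [set w | u (S 0 w) <= x].
have mA : measurable A by exact: measurable_state_le.
have uS_meas : measurable_fun setT (fun w => u (S 0 w)) by exact: (measurable_RV_comp S 0 u_meas).
have cq : expR (- c') <= fine (P A).
  have ae1 : {ae P, forall w, x <= u (S 0 w)}.
    have sub : ~` [set w | x <= u (S 0 w)] `<=`
        \bigcup_k [set w | u (S 0 w) <= x - k.+1%:R^-1].
      move=> w /= /negP; rewrite -ltNge => ux.
      have [k] := ltr_add_invr ux; rewrite -ltrBrDr => /ltW ?.
      by exists k.
    apply: (negligibleS sub); apply: negligible_bigcup => k.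
    apply/negligibleP; first exact: measurable_state_le.
    by apply: H0; rewrite invr_gt0.
  (* The truncation at 0 changes nothing almost surely and makes the domination by 1 hold
     everywhere. As [k] grows, [f k] tends to the indicator of [u <= x]. *)
  pose f k w := (expR (- k%:R * Num.max 0 (u (S 0 w) - x)))%:E.
  have mf k : measurable_fun setT (f k).
    apply/measurable_EFinP; apply: measurableT_comp => //.
    apply: measurable_funM => //; apply: measurable_maxr => //.
    exact: measurable_funB.
  have f01 k w : (0 <= f k w <= 1)%E.
    rewrite !lee_fin; apply: expR_mulNneg_unit; first by rewrite oppr_le0.
    by rewrite le_max lexx.
  have [_ _ cvg_int] : [/\ P.-integrable setT (EFin \o \1_A),
    [sequence (\int[P]_w (fun k w => `|f k w - (\1_A w)%:E|) k w)%E]_k @ \oo --> 0%E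
    & [sequence (\int[P]_w f k w)%E]_k @ \oo --> (\int[P]_w (\1_A w)%:E)%E].
    apply: (@dominated_convergence _ _ _ P setT measurableT f _ (cst 1%E)) => //.
    - exact/measurable_EFinP/measurable_indicP.
    - apply: aeW => w _; rewrite /f /= indicE.
      have [ux|ux] := leP (u (S 0 w)) x.
        rewrite mem_set//; apply: cvg_near_cst; apply: nearW => k.
        by rewrite max_l ?subr_le0// mulr0 expR0.
      rewrite memNset; last by rewrite /A /= ; apply/negP; rewrite -ltNge.
      apply: cvg_EFin; first exact: nearW.
      rewrite (_ : fine \o _ = (fun k => expR (- (u (S 0 w) - x)) ^+ k)); last first.
        apply/funext => k /=; rewrite max_r ?subr_ge0 ?(ltW ux)//.
        by rewrite -expRM_natl mulNr mulrN.
      apply: cvg_expr; rewrite ger0_norm ?expR_ge0// -expR0 ltr_expR oppr_lt0.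
      by rewrite subr_gt0.
    - by apply: finite_measure_integrable_cst.
    - apply: aeW => w k _; rewrite gee0_abs; by case/andP: (f01 k w).
  rewrite -lee_fin fineK ?fin_num_measure//.
  have -> : (P A = \int[P]_w (\1_A w)%:E)%E by rewrite integral_indic// setIT.
  apply: (cvge_to_ge cvg_int); apply: nearW => k /=.
  have k0 : - k%:R <= 0 :> R by rewrite oppr_le0.
  apply: (@le_trans _ _ (expR (k%:R * x) * M (- k%:R))%:E).
    rewrite lee_fin -[M _]lnK ?posrE ?M_gt0// -expRD ler_expR.
    by have := I _ k0; lra.
  rewrite EFinM -(mgfE iidS u_meas u0)// -ge0_integralZl_EFin ?expR_ge0//; last first.
    apply/measurable_EFinP.
    by have := measurable_expRM (- k%:R) uS_meas; apply.
  apply: ae_ge0_le_integral => //.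
  - apply: emeasurable_funM => //; apply/measurable_EFinP.
    by have := measurable_expRM (- k%:R) uS_meas; apply.
  - by move=> w _; case/andP: (f01 k w).
  - apply: filterS ae1 => w ux _.
    rewrite /f -EFinM lee_fin -expRD ler_expR max_r ?subr_ge0//; lra.
(* If each of the [n] states satisfies [u <= x], then the sum is at most [n x]; by independence this
   has probability [P A ^+ n]. *)
pose h := \1_[set t | u t <= x] : T -> R.
have mh : measurable [set t | u t <= x].
  rewrite -[X in measurable X]setTI (_ : [set w | _] = u @^-1` `]-oo, x]).
    exact: u_meas.
  by apply/seteqP; split => w /=; rewrite in_itv.
have h_meas : measurable_fun setT h by exact/measurable_indicP.
have h01 t : 0 <= h t <= 1 by rewrite /h indicE ler0n lern1 leq_b1.
have E := expect_iid_prod iidS n h_meas h01.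
have Eh : expect P (fun w => h (S 0 w)) = fine (P A).
  by rewrite /expect; congr fine; rewrite -[in RHS](setIT A) -integral_indic.
rewrite Eh in E.
apply: (@le_trans _ _ ((fine (P A)) ^+ n)%:E).
  rewrite lee_fin lerXn2r ?nnegrE ?expR_ge0 ?fine_ge0//.
  by apply: le_trans cq; rewrite ler_expR lerN2 ltW.
rewrite -E.
set B := [set w | _].
have mB : measurable B by exact: measurable_sum_le.
rewrite -[B]setIT -integral_indic//.
apply: ge0_le_integral => //.
- by move=> w _; rewrite lee_fin; apply: prodr_ge0 => k _; rewrite /h indicE.
- apply/measurable_EFinP; apply: measurable_prod => k _.
  by apply: (measurable_RV_comp S k (h := h)); exact/measurable_indicP.
- exact/measurable_EFinP/measurable_indicP.
- move=> w _; rewrite lee_fin [leRHS]indicE; case: (boolP (w \in B)) => wB.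
    by apply: prodr_ile1 => k _; rewrite /h indicE ler0n lern1 leq_b1.
  have [k Hk] : exists k : 'I_n, x < u (S k w).
    apply: contrapT => Hn; move/negP: wB; apply; rewrite inE /B /= /sum_states.
    rewrite -[in leRHS](card_ord n) mulr_natl -sumr_const.
    apply: ler_sum => k _; rewrite leNgt; apply/negP => ?; apply: Hn; by exists k.
  rewrite (bigD1 k)//= /h indicE memNset ?mul0r//.
  by apply/negP; rewrite -ltNge.
Qed.

(** Either some mass of [u] lies strictly below [x] and tilting works, or there is none and the edge
    case applies. *)
Lemma cramer_lower_bound (c c' : R) :
  (forall l, l <= 0 -> l * x - ln (M l) <= c') -> c' < c ->
  \forall n \near \oo,
    ((expR (- c) ^+ n)%:E <= P [set w | (sum_states S u n w <= n%:R * x)%R])%E.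
Proof.
move=> I c'c.
have [[delta delta0 Pd]|H] := pselect (exists2 delta, 0 < delta &
    P [set w | u (S 0 w) <= x - 2 * delta] != 0%E).
  exact: (cramer_tilt delta0 Pd I c'c).
apply: nearW; apply: cramer_edge I c'c => delta delta0.
apply: contrapT => /eqP Pd; apply: H; exists (delta / 2); first by rewrite divr_gt0.
by rewrite (_ : 2 * (delta / 2) = delta)//; lra.
Qed.

End cramer.

(** * Exponents as extended real limits, and Laplace transforms near 0 *)

(** Testing against real bounds on each side treats finite and infinite exponents uniformly: one of
    the two conditions is vacuous when [e] is infinite. *)
Lemma ereal_cvg_dense (R : realType) (v : nat -> \bar R) (e : \bar R) :
  (forall c : R, (c%:E < e)%E -> \forall n \near \oo, (c%:E <= v n)%E) ->
  (forall c : R, (e < c%:E)%E -> \forall n \near \oo, (v n <= c%:E)%E) ->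
  v n @[n --> \oo] --> e.
Proof.
case: e => [e| |] lo hi; last 2 first.
- by apply/cvgeyPge => c; apply: lo; rewrite ltry.
- by apply/cvgeNyPle => c; apply: hi; rewrite ltNyr.
apply/fine_cvgP; split.
  have := lo (e - 1); have := hi (e + 1).
  rewrite !lte_fin ltrDl ltr01 gtrBl ltr01 => /(_ isT) h1 /(_ isT) h2.
  near=> n; rewrite fin_numElt; apply/andP; split.
    by apply: (@lt_le_trans _ _ (e - 1)%:E); [rewrite ltNyr|near: n].
  by apply: (@le_lt_trans _ _ (e + 1)%:E); [near: n|rewrite ltry].
apply/cvgrPdist_le => r r0.
have h1 : \forall n \near \oo, ((e - r)%:E <= v n)%E.
  by apply: lo; rewrite lte_fin gtrBl.
have h2 : \forall n \near \oo, (v n <= (e + r)%:E)%E.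
  by apply: hi; rewrite lte_fin ltrDl.
near=> n => /=.
have : ((e - r)%:E <= v n)%E by near: n.
have : (v n <= (e + r)%:E)%E by near: n.
case: (v n) => [s| |] //=; rewrite ?leye_eq ?leeNy_eq//.
by rewrite !lee_fin distrC ler_distl => -> ->.
Unshelve. all: end_near. Qed.

Lemma ge_exponent_of_le (R : realType) (p : \bar R) (c : R) (K : nat) :
  (0 < K)%N -> (p <= (expR (- c) ^+ K)%:E)%E ->
  (c%:E <= - lne p * (K%:R^-1)%:E)%E.
Proof.
move=> K0 pc.
rewrite -lee_pdivrMr -?EFinM; last by rewrite invr_gt0 ltr0n.
rewrite invrK leeNr -EFinN.
rewrite -lee_expeR; have [p0|p0] := leP 0%E p; last first.
  by rewrite le0_lneNy ?(ltW p0)//= lee_fin expR_ge0.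
rewrite lneK ?in_itv/= ?p0 ?leey//.
by rewrite (_ : - _ = K%:R * - c) ?expRM_natl//; ring.
Qed.

Lemma le_exponent_of_ge (R : realType) (p : \bar R) (c : R) (K : nat) :
  (0 < K)%N -> ((expR (- c) ^+ K)%:E <= p)%E ->
  (- lne p * (K%:R^-1)%:E <= c%:E)%E.
Proof.
move=> K0 pc.
rewrite -lee_pdivlMr -?EFinM; last by rewrite invr_gt0 ltr0n.
rewrite invrK leeNl -EFinN.
rewrite -lee_expeR lneK ?in_itv/= ?leey ?andbT//; last first.
  by apply: le_trans pc; rewrite lee_fin exprn_ge0// expR_ge0.
by rewrite (_ : - _ = K%:R * - c) ?expRM_natl//; ring.
Qed.

Lemma expRN_le_inv1D (R : realType) (z : R) : 0 <= z -> expR (- z) <= 1 - z / (1 + z).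
Proof.
move=> z0; have z1 : 0 < 1 + z by lra.
rewrite (_ : 1 - _ = (1 + z)^-1); last by field; rewrite gt_eqF.
by rewrite expRN lef_pV2 ?posrE ?expR_gt0// expR_ge1Dx.
Qed.

Section mean.
Context {d d' : measure_display} {Omega : measurableType d}
  {T : measurableType d'} {R : realType} (P : probability Omega R).
Variables (S : nat -> {RV P >-> T}) (iidS : iid S).
Variables (u : T -> R) (u_meas : measurable_fun setT u) (u0 : forall t, 0 <= u t).

(* (1 - exp(- t u)) / t >= u / (1 + t u), which increases to u as t decreases to 0. *)
Lemma mgf_lt_of_lt_mean (y : R) : (y%:E < \int[P]_w (u (S 0 w))%:E)%E ->
  exists2 t, 0 < t & mgf S u (- t) < expR (- (t * y)).
Proof.
move=> ym.
have uS_meas : measurable_fun setT (fun w => u (S 0 w)) by exact: (measurable_RV_comp S 0 u_meas).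
pose t n : R := n.+1%:R^-1.
have t0 n : 0 < t n by rewrite invr_gt0.
pose g n w := u (S 0 w) / (1 + t n * u (S 0 w)).
have den n w : 0 < 1 + t n * u (S 0 w) by rewrite ltr_pwDl// mulr_ge0// ltW.
have g0 n w : 0 <= g n w by rewrite divr_ge0// ltW.
have mg n : measurable_fun setT (g n).
  apply: measurable_funM => //.
  under eq_fun do rewrite -powR_inv1 ?ltW//.
  apply: (measurableT_comp (measurable_powR (- 1))).
  by apply: measurable_funD => //; apply: measurable_funM.
(* Monotone convergence, which also covers an infinite mean. *)
have [n ygn] : exists n, (y%:E < \int[P]_w (g n w)%:E)%E.
  apply: contrapT => /forallNP H; move: ym; apply/negP; rewrite -leNgt.
  have -> : (\int[P]_w (u (S 0 w))%:E = \int[P]_w limn (fun n => (g n w)%:E))%E.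
    apply: eq_integral => w _; apply/esym/cvg_lim => //.
    apply: cvg_EFin; first exact: nearW.
    rewrite -[X in _ --> X]divr1 -[X in _ / X]addr0 -[X in _ / (_ + X)](mul0r (u (S 0 w))).
    apply: cvgM; first exact: cvg_cst.
    apply: cvgV; first by rewrite mul0r addr0 oner_neq0.
    apply: cvgD; first exact: cvg_cst.
    apply: cvgM; last exact: cvg_cst.
    exact: cvg_harmonic.
  have C : (\int[P]_w (g n w)%:E)%E @[n --> \oo] --> (\int[P]_w limn (fun n => (g n w)%:E))%E.
    apply: (@cvg_monotone_convergence _ _ _ P _ measurableT (fun n w => (g n w)%:E)) => //.
    - by move=> n; exact/measurable_EFinP.
    - by move=> n w _; rewrite lee_fin.
    - move=> w _ m n mn; rewrite lee_fin ler_wpM2l// lef_pV2 ?posrE// lerD2l.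
      by rewrite ler_wpM2r// lef_pV2 ?posrE ?ltr0n// ler_nat ltnS.
  apply: (cvge_to_le C); apply: nearW => n; rewrite leNgt; apply/negP.
  exact: H.
exists (t n) => //.
have tn0 : - t n <= 0 by rewrite oppr_le0 ltW.
have mE : measurable_fun setT (fun w => expR (- t n * u (S 0 w))).
  by have := measurable_expRM (- t n) uS_meas; apply.
have H : ((mgf S u (- t n))%:E + (t n)%:E * \int[P]_w (g n w)%:E <= 1)%E.
  rewrite -(mgfE iidS u_meas u0)// -ge0_integralZl_EFin//; [|by move=> w _; rewrite lee_fin|exact/measurable_EFinP|exact: ltW].
  rewrite -ge0_integralD//; [|exact/measurable_EFinP|by move=> w _; rewrite -EFinM lee_fin mulr_ge0// ltW|by apply: emeasurable_funM => //; exact/measurable_EFinP].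
  apply: (@le_trans _ _ (\int[P]_w (cst 1%E w))%E).
    apply: ge0_le_integral => //.
    - by move=> w _; rewrite -EFinM -EFinD lee_fin addr_ge0 ?expR_ge0// mulr_ge0// ltW.
    - apply: emeasurable_funD; first exact/measurable_EFinP.
      by apply: emeasurable_funM => //; exact/measurable_EFinP.
    - move=> w _; rewrite -EFinM -EFinD lee_fin mulNr.
      have tu0 : 0 <= t n * u (S 0 w) by rewrite mulr_ge0// ltW.
      have := expRN_le_inv1D tu0; rewrite /g mulrA; lra.
  by rewrite integral_cst// mul1e; exact: probability_le1.
(* Finite because [t n] times this integral is at most 1 by [H]. *)
have gfin : (\int[P]_w (g n w)%:E)%E \is a fin_num.
  rewrite ge0_fin_numE; last by apply: integral_ge0 => w _; rewrite lee_fin.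
  rewrite ltey; apply/eqP => E; move: H; rewrite E gt0_muley ?lte_fin//.
move: H ygn; rewrite -(fineK gfin) -EFinM -EFinD lee_fin lte_fin.
set G := fine _ => H ygn.
(* The chain is [M(- t) <= 1 - t G < 1 - t y <= exp(- t y)]. *)
have : t n * y < t n * G by rewrite ltr_pM2l.
have := expR_ge1Dx (- (t n * y)).
by lra.
Qed.

End mean.

(** * Wideband outage *)

Section slope.
Context {d' : measure_display} {T : measurableType d'} {R : realType}.
Variable J : R -> T -> R.
Hypothesis J_ge0 : forall (g : R) (s : T), 0 < g -> 0 <= J g s.
Hypothesis J_meas : forall g : R, 0 < g -> measurable_fun [set: T] (J g).
Hypothesis J_noninc : forall (s : T) (g g' : R), 0 < g -> g <= g' -> J g' s / g' <= J g s / g.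
Hypothesis J_lim : forall s : T, cvg ((J g s / g)%:E @[g --> 0^'+]).

Lemma slope0_ge (g : R) (s : T) : 0 < g -> ((J g s / g)%:E <= slope0 J s)%E.
Proof.
move=> g0; rewrite /slope0; apply: (cvge_to_ge (@J_lim s)).
near=> h; rewrite lee_fin; apply: J_noninc; first by near: h; exact: nbhs_right_gt.
by apply: ltW; near: h; exact: nbhs_right_lt.
Unshelve. all: end_near. Qed.

Lemma slope0_ge0 (s : T) : (0 <= slope0 J s)%E.
Proof.
by apply: le_trans (slope0_ge s ltr01); rewrite lee_fin divr1 J_ge0.
Qed.

(** The index is shifted because [rho / 0 = 0], and nothing is assumed about [J] at cost 0. *)
Lemma cvg_slope0 (rho : R) (s : T) : 0 < rho ->
  (J (rho / K.+1%:R) s / (rho / K.+1%:R))%:E @[K --> \oo] --> slope0 J s.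
Proof.
move=> rho0.
have h : rho / K.+1%:R @[K --> \oo] --> 0^'+.
  have h0 : rho / K.+1%:R @[K --> \oo] --> (0 : R).
    by rewrite -(mulr0 rho); apply: cvgM; [exact: cvg_cst|exact: cvg_harmonic].
  move=> A; rewrite /at_right /within /= => hA.
  have [n _ Hn] := h0 _ hA; exists n => // K nK.
  by apply: (Hn K nK); rewrite divr_gt0.
exact: (cvg_comp _ _ h (@J_lim s)).
Qed.

(** Monotone or not, a limit over all small costs need not be visibly measurable; along the costs
    [1 / K.+1] it is a limit of a sequence of measurable functions. *)
Lemma measurable_slope0 : measurable_fun setT (slope0 J).
Proof.
apply: (emeasurable_fun_cvg (fun K s => (J (1 / K.+1%:R) s / (1 / K.+1%:R))%:E)).
  move=> K; apply/measurable_EFinP; apply: measurable_funM => //.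
  by apply: J_meas; rewrite divr_gt0.
by move=> s _; exact: cvg_slope0.
Qed.

End slope.

Section wideband_outage.
Context {d d' : measure_display} {Omega : measurableType d}
  {T : measurableType d'} {R : realType} (P : probability Omega R).
Variables (S : nat -> {RV P >-> T}) (iidS : iid S) (J : R -> T -> R).
Hypothesis J_ge0 : forall (g : R) (s : T), 0 < g -> 0 <= J g s.
Hypothesis J_meas : forall g : R, 0 < g -> measurable_fun [set: T] (J g).
Hypothesis J_noninc : forall (s : T) (g g' : R), 0 < g -> g <= g' -> J g' s / g' <= J g s / g.
Hypothesis J_lim : forall s : T, cvg ((J g s / g)%:E @[g --> 0^'+]).
Variable rho : R.
Hypothesis rho_gt0 : 0 < rho.
Hypothesis slope0_fin : {ae P, forall w, slope0 J (S 0 w) \is a fin_num}.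

(* [fine +oo = 0], but the slope is almost surely finite. *)
Definition rslope (s : T) : R := fine (slope0 J s).

Definition chord (K : nat) (s : T) : R := J (rho / K%:R) s / (rho / K%:R).

Lemma rslope_ge0 s : 0 <= rslope s.
Proof. by apply: fine_ge0; exact: slope0_ge0. Qed.

Lemma measurable_rslope : measurable_fun setT rslope.
Proof. by apply: measurableT_comp => //; exact: measurable_slope0. Qed.

Lemma chord_ge0 K s : (0 < K)%N -> 0 <= chord K s.
Proof. by move=> K0; rewrite divr_ge0 ?J_ge0 ?divr_ge0 ?divr_gt0 ?ltr0n ?(ltW rho_gt0). Qed.

Lemma measurable_chord K : (0 < K)%N -> measurable_fun setT (chord K).
Proof.
move=> K0; apply: measurable_funM => //.
by apply: J_meas; rewrite divr_gt0 ?ltr0n.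
Qed.

Lemma rateE K w : (0 < K)%N -> rate J S K rho w = rho / K%:R * sum_states S (chord K) K w.
Proof.
move=> K0; rewrite /rate /sum_states mulr_sumr; apply: eq_bigr => k _.
by rewrite /chord mulrCA divff ?mulr1// gt_eqF// divr_gt0 ?ltr0n.
Qed.

Lemma rate_leE K w x : (0 < K)%N ->
  (rate J S K rho w <= rho * x) = (sum_states S (chord K) K w <= K%:R * x).
Proof.
move=> K0; rewrite rateE// mulrAC -mulrA ler_pM2l// ler_pdivrMr ?ltr0n//.
by rewrite (mulrC x).
Qed.

Lemma measurable_rate_le K x : (0 < K)%N -> measurable [set w | rate J S K rho w <= rho * x].
Proof.
move=> K0; rewrite (_ : [set w | _] = [set w | sum_states S (chord K) K w <= K%:R * x]).
  exact: (measurable_sum_le S (measurable_chord K0)).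
by apply/seteqP; split => w /=; rewrite rate_leE.
Qed.

(** Dominated convergence with bound 1. Almost sure finiteness of the slope matters: where the slope
    is [+oo], [rslope] is 0 and is not the limit of the chords. *)
Lemma cvg_mgf_chord l : l <= 0 ->
  mgf S (chord K.+1) l @[K --> \oo] --> mgf S rslope l.
Proof.
move=> l0.
have mc K := measurable_chord (ltn0Sn K).
have c0 K s : 0 <= chord K.+1 s by exact: chord_ge0.
have [_ _] : [/\ P.-integrable setT (fun w => (expR (l * rslope (S 0 w)))%:E),
    [sequence (\int[P]_w (fun K w => `|(expR (l * chord K.+1 (S 0 w)))%:E
        - (expR (l * rslope (S 0 w)))%:E|) K w)%E]_K @ \oo --> 0%E
    & [sequence (\int[P]_w (expR (l * chord K.+1 (S 0 w)))%:E)%E]_K @ \oo -->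
      (\int[P]_w (expR (l * rslope (S 0 w)))%:E)%E].
  apply: (@dominated_convergence _ _ _ P setT measurableT
    (fun K w => (expR (l * chord K.+1 (S 0 w)))%:E) _ (cst 1%E)) => //.
  - move=> K; apply/measurable_EFinP.
    by have := measurable_expRM l (measurable_RV_comp S 0 (mc K)); apply.
  - apply/measurable_EFinP.
    by have := measurable_expRM l (measurable_RV_comp S 0 measurable_rslope); apply.
  - apply: filterS slope0_fin => w wfin _.
    apply: cvg_EFin; first exact: nearW.
    apply: (continuous_cvg _ (@continuous_expR R _)).
    apply: cvgM; first exact: cvg_cst.
    have := @cvg_slope0 _ _ _ _ J_lim rho (S 0 w) rho_gt0.
    by rewrite -(fineK wfin); exact: fine_cvg.
  - exact: finite_measure_integrable_cst.
  - apply: aeW => w K _; rewrite gee0_abs ?lee_fin ?expR_ge0//.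
    by case/andP: (expR_mulNneg_unit l0 (c0 K (S 0 w))).
rewrite /= (mgfE iidS measurable_rslope rslope_ge0 l0) => H.
apply: fine_cvg; apply: cvg_trans H.
apply: near_eq_cvg; apply: nearW => K /=.
by rewrite (mgfE iidS (mc K) (c0 K) l0).
Qed.

(** The summands themselves change with [K], so Chernoff's bound is applied to each row [chord K]
    with [K] terms. The strict inequality absorbs the gap between the transforms of chord and slope
    for large [K]. *)
Lemma outage_upper l x c : l <= 0 -> expR (- (l * x)) * mgf S rslope l < expR (- c) ->
  \forall K \near \oo,
    (P [set w | (rate J S K rho w <= rho * x)%R] <= (expR (- c) ^+ K)%:E)%E.
Proof.
move=> l0 Hl.
have C : expR (- (l * x)) * mgf S (chord K.+1) l @[K --> \oo] -->
    expR (- (l * x)) * mgf S rslope l.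
  by apply: cvgM; [exact: cvg_cst|exact: cvg_mgf_chord].
have [n _ Hn] := cvgr_lt _ C _ Hl.
exists n.+1 => // -[//|K] nK.
have NK : expR (- (l * x)) * mgf S (chord K.+1) l < expR (- c) := Hn K nK.
rewrite (_ : [set w | _] = [set w | sum_states S (chord K.+1) K.+1 w <= K.+1%:R * x]); last first.
  by apply/seteqP; split => w /=; rewrite rate_leE.
apply: le_trans.
  apply: (chernoff_lower iidS (measurable_chord (ltn0Sn K)) _ K.+1 x l0).
  by move=> s; exact: chord_ge0.
rewrite lee_fin lerXn2r ?nnegrE ?expR_ge0 ?(ltW NK)//.
by rewrite mulr_ge0 ?expR_ge0// mgf_ge0.
Qed.

Lemma outage_lower K x : (0 < K)%N ->
  (P [set w | (sum_states S rslope K w <= K%:R * x)%R] <=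
   P [set w | (rate J S K rho w <= rho * x)%R])%E.
Proof.
move=> K0.
pose F := [set s | slope0 J s \is a fin_num].
have mF : measurable F.
  rewrite -[F]setTI; apply: emeasurable_fin_num => //.
  exact: measurable_slope0.
(* Where some slope is infinite, [rslope] is 0 and need not dominate the chord. Identical
   distribution makes these events null for every [k], so removing them costs nothing. *)
pose N := \bigcup_k (S k @^-1` ~` F).
have mSF k : measurable (S k @^-1` ~` F).
  rewrite -[_ @^-1` _]setTI; apply: (measurable_funP (S k)) => //.
  exact: measurableC.
have mN : measurable N by apply: bigcup_measurable.
have N0 : P N = 0%E.
  apply/negligibleP => //; apply: negligible_bigcup => k.
  apply/negligibleP => //.
  transitivity (P (S 0 @^-1` ~` F)); first exact: (iidS.2 k _ (measurableC mF)).
  exact/negligibleP.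
rewrite -(measureU0 (mu := P) (measurable_rate_le x K0) mN N0).
apply: le_measure; rewrite ?inE.
- exact: (measurable_sum_le S measurable_rslope).
- by apply: measurableU => //; exact: measurable_rate_le.
- move=> w /= sx.
  have [Nw|Nw] := pselect (N w); first by right.
  left; rewrite rate_leE//; apply: le_trans sx; apply: ler_sum => k _.
  rewrite -lee_fin /rslope fineK; first by apply: slope0_ge => //; rewrite divr_gt0 ?ltr0n.
  by apply: contrapT => H; apply: Nw; exists k.
Qed.

End wideband_outage.

(** * The logarithmic moment generating function of the slope, and the outage exponent *)

Section wideband_exponent.
Context {d d' : measure_display} {Omega : measurableType d}
  {T : measurableType d'} {R : realType} (P : probability Omega R).
Variables (S : nat -> {RV P >-> T}) (iidS : iid S) (J : R -> T -> R).
Hypothesis J_ge0 : forall (g : R) (s : T), 0 < g -> 0 <= J g s.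
Hypothesis J_meas : forall g : R, 0 < g -> measurable_fun [set: T] (J g).
Hypothesis J_noninc : forall (s : T) (g g' : R), 0 < g -> g <= g' -> J g' s / g' <= J g s / g.
Hypothesis J_lim : forall s : T, cvg ((J g s / g)%:E @[g --> 0^'+]).
Local Notation X := (fun w => slope0 J (S 0 w)).
Local Notation Lambda := (log_mgf P X).
Local Notation M := (mgf S (rslope J)).
Hypothesis Lambda_gtNy : forall l, (-oo < Lambda l)%E.
Hypothesis Lambda_derivable : forall l, (effective_domain Lambda)° l ->
  derivable (fine \o Lambda) l 1.
Hypothesis Lambda_lsc : lower_semicontinuous Lambda.

Lemma measurable_X : measurable_fun setT X.
Proof.
apply: (@measurableT_comp _ _ _ _ _ _ (slope0 J)) => //.
exact: measurable_slope0.
Qed.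

Let F := [set w | X w \is a fin_num].

Let mF : measurable F.
Proof. by rewrite -[F]setTI; apply: emeasurable_fin_num => //; exact: measurable_X. Qed.

(** Strictness matters: [exp(l X)] vanishes at [X = +oo] for [l < 0], but equals 1 there for
    [l = 0]. This jump is what lower semicontinuity forbids. *)
Lemma expeR_XE l w : l < 0 ->
  expeR (l%:E * X w) = (expR (l * rslope J (S 0 w)) * \1_F w)%:E.
Proof.
move=> l0; rewrite indicE; case: (boolP (w \in F)) => wF.
  rewrite mulr1 /rslope; rewrite inE in wF.
  by rewrite -[in LHS](fineK wF) -EFinM.
have -> : X w = +oo%E.
  apply/eqP; rewrite -leye_eq leNgt -ge0_fin_numE ?slope0_ge0//.
  by apply: contra wF; rewrite inE.
by rewrite lt0_muley ?lte_fin// mulr0.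
Qed.

Lemma measurable_expeR_X l : l <= 0 -> measurable_fun setT (fun w => expeR (l%:E * X w)).
Proof.
rewrite le_eqVlt => /predU1P[->|l0].
  by under eq_fun do rewrite mul0e expeR0; exact: measurable_cst.
under eq_fun do rewrite expeR_XE//.
apply/measurable_EFinP; apply: measurable_funM; last exact/measurable_indicP.
have mr : measurable_fun setT (rslope J) by exact: measurable_rslope.
by have := measurable_expRM l (measurable_RV_comp S 0 mr); apply.
Qed.

Lemma log_mgf0 : Lambda 0 = 0%E.
Proof.
rewrite /log_mgf; under eq_integral do rewrite mul0e expeR0.
rewrite -[RHS](lne1 R) integral_cst// mul1e; congr lne.
exact: probability_setT.
Qed.

(* For l < 0 the event {X = +oo} does not contribute to Lambda l, so lower
   semicontinuity at 0 rules it out. *)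
Lemma slope0_fin_ae : {ae P, forall w, slope0 J (S 0 w) \is a fin_num}.
Proof.
have X0 w : (0 <= X w)%E by exact: slope0_ge0.
(* As [Lambda 0 = 0 > a], some [l < 0] near 0 has [Lambda l > a], while [exp(l X)] is at most the
   indicator of [F]. Letting [a] increase to 0 gives [P F = 1]. *)
have H (a : R) : a < 0 -> ((expR a)%:E <= P F)%E.
  move=> a0; have [|V] := @Lambda_lsc 0 a; first by rewrite log_mgf0 lte_fin.
  move=> /nbhs_ballP[r /= r0 rV] aV.
  have /aV : V (- (r / 2)).
    by apply: rV; rewrite /ball /= sub0r opprK gtr0_norm ?divr_gt0//; lra.
  rewrite /log_mgf; set I := (\int[P]_w _)%E => aI.
  have I0 : (0 <= I)%E by apply: integral_ge0 => w _; exact: expeR_ge0.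
  have : (expeR a%:E < I)%E.
    by rewrite -[I]lneK ?lte_expeR// in_itv/= I0 leey.
  move=> /ltW /le_trans; apply.
  have -> : (P F = \int[P]_w (\1_F w)%:E)%E by rewrite integral_indic// setIT.
  have r0' : - (r / 2) < 0 by rewrite oppr_lt0 divr_gt0.
  apply: ge0_le_integral => //.
  - by move=> w _; exact: expeR_ge0.
  - by apply: measurable_expeR_X; exact: ltW.
  - exact/measurable_EFinP/measurable_indicP.
  - move=> w _; rewrite expeR_XE// lee_fin ler_piMl//.
    by have /andP[] := expR_mulNneg_unit (ltW r0') (fine_ge0 (X0 w)).
have PF : P F = 1%E.
  apply/eqP; rewrite eq_le probability_le1//=.
  have C : (expR (- n.+1%:R^-1))%:E @[n --> \oo] --> (1%:E : \bar R).
    have C0 : expR (- n.+1%:R^-1) @[n --> \oo] --> expR (- (0 : R)).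
      apply: (continuous_cvg _ (@continuous_expR R _)); apply: cvgN.
      exact: cvg_harmonic.
    apply: cvg_EFin; first exact: nearW.
    by rewrite oppr0 expR0 in C0.
  apply: (cvge_to_le C); apply: nearW => n; apply: H.
  by rewrite oppr_lt0 invr_gt0.
exists (~` F); split => //; first exact: measurableC.
by rewrite probability_setC// PF subee.
Qed.

Let mrX : measurable_fun setT (rslope J).
Proof. exact: measurable_rslope. Qed.

Let rX0 s : 0 <= rslope J s.
Proof. exact: rslope_ge0. Qed.

Lemma log_mgfE l : l <= 0 -> Lambda l = lne (M l)%:E.
Proof.
move=> l0; rewrite /log_mgf -(mgfE iidS mrX rX0 l0); congr lne.
apply: ge0_ae_eq_integral => //.
- exact: measurable_expeR_X.
- apply/measurable_EFinP.
  by have := measurable_expRM l (measurable_RV_comp S 0 mrX); apply.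
- by move=> w _; exact: expeR_ge0.
- apply: filterS slope0_fin_ae => w wfin _.
  by rewrite /rslope -[in LHS](fineK wfin) -EFinM.
Qed.

Lemma mgf_rslope_gt0 l : l <= 0 -> 0 < M l.
Proof.
move=> l0; rewrite ltNge; apply/negP => M0.
by have := Lambda_gtNy l; rewrite log_mgfE// le0_lneNy// lee_fin.
Qed.

Lemma log_mgf_ln l : l <= 0 -> Lambda l = (ln (M l))%:E.
Proof. by move=> l0; rewrite log_mgfE// lne_EFin// mgf_rslope_gt0. Qed.

Lemma mgf_rslope_le1 l : l <= 0 -> M l <= 1.
Proof.
move=> l0; rewrite -lee_fin -(mgfE iidS mrX rX0 l0).
apply: (@le_trans _ _ (\int[P]_w (cst 1%E w))%E).
  apply: ge0_le_integral => //.
  - apply/measurable_EFinP.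
    by have := measurable_expRM l (measurable_RV_comp S 0 mrX); apply.
  - by move=> w _; rewrite lee_fin; case/andP: (expR_mulNneg_unit l0 (rX0 (S 0 w))).
by rewrite integral_cst// mul1e; exact: probability_le1.
Qed.

(** Lower semicontinuity gives [Lambda l > - e] near 0, hence [M l > exp(- e) >= 1 - e]; the upper
    bound is [M l <= 1]. *)
Lemma mgf_rslope_cvg1 : M l @[l --> 0^'-] --> (1 : R).
Proof.
apply/cvgrPdist_le => e e0.
have [|V V0 HV] := @Lambda_lsc 0 (- e); first by rewrite log_mgf0 lte_fin oppr_lt0.
have V0' : \forall k \near 0^'-, V k.
  by rewrite /at_left near_withinE; apply: filterS V0.
near=> l.
have l0 : l < 0 by near: l; exact: nbhs_left_lt.
have Vl : V l by near: l.
rewrite ger0_norm ?subr_ge0 ?mgf_rslope_le1 ?(ltW l0)//.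
have := HV _ Vl; rewrite log_mgf_ln ?(ltW l0)// lte_fin -ltr_expR.
rewrite lnK ?posrE ?mgf_rslope_gt0 ?(ltW l0)//.
have := expR_ge1Dx (- e); lra.
Unshelve. all: end_near. Qed.

(** Lambda is finite on the whole negative half-line, which therefore lies in the interior of the
    effective domain. *)
Lemma mgf_rslope_derivable l : l < 0 -> derivable (fun l => ln (M l)) l 1.
Proof.
move=> l0.
have N : \forall k \near l, k < 0 by exact: lt_nbhsl.
apply: (@near_eq_derivable _ _ _ (fine \o Lambda)).
  by apply: filterS N => k k0 /=; rewrite log_mgf_ln// ltW.
apply: Lambda_derivable; rewrite /interior /=.
apply: filterS N => k k0 /=; rewrite /effective_domain /=.
by rewrite log_mgf_ln ?ltry// ltW.
Qed.

Local Notation mean := (\int[P]_w X w)%E.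

Lemma mean_rslope : mean = (\int[P]_w (rslope J (S 0 w))%:E)%E.
Proof.
apply: ge0_ae_eq_integral => //.
- exact: measurable_X.
- by apply/measurable_EFinP; exact: (measurable_RV_comp S 0 mrX).
- by move=> w _; exact: slope0_ge0.
- by move=> w _; rewrite lee_fin.
- by apply: filterS slope0_fin_ae => w wfin _; rewrite /rslope fineK.
Qed.

Lemma mgf_rslope_lt y : (y%:E < mean)%E ->
  exists2 t, 0 < t & M (- t) < expR (- (t * y)).
Proof. by rewrite mean_rslope => /(mgf_lt_of_lt_mean iidS mrX rX0). Qed.

Variable rho : R.
Hypothesis rho_gt0 : 0 < rho.

Lemma outage_exponent (x : R) : (x%:E <= mean)%E ->
  (- lne (outage J S K rho (rho * x)%:E) * (K%:R^-1)%:E)%E @[K --> \oo] -->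
  ereal_sup [set (l%:E * x%:E - Lambda l)%E | l in [set l : R | l <= 0]].
Proof.
move=> xm; set I := ereal_sup _.
have IE l : l <= 0 -> ((l * x - ln (M l))%:E <= I)%E.
  move=> l0; apply: ereal_sup_ubound; exists l => //.
  by rewrite log_mgf_ln.
have Kpos : \forall K \near \oo, (0 < K)%N by exists 1%N.
apply: ereal_cvg_dense => c.
- move=> /ereal_sup_gt[_ [l /= l0 <-]].
  rewrite log_mgf_ln// -EFinM -EFinB lte_fin => cl.
  have : expR (- (l * x)) * M l < expR (- c).
    rewrite -[M l]lnK ?posrE ?mgf_rslope_gt0// -expRD ltr_expR; lra.
  move=> /(outage_upper iidS J_ge0 J_meas J_noninc J_lim rho_gt0 slope0_fin_ae l0) H.
  near=> K; apply: ge_exponent_of_le; first by near: K.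
  by rewrite /outage; under eq_set do rewrite lee_fin; near: K.
- move=> Ic.
  (* The parameter [l = 0] contributes 0. With a real [c] above [I], this makes [I] finite, so
     [fine I] can serve as the bound [c'] in Cramer's lower bound. *)
  have I0 : (0 <= I)%E.
    apply: le_trans (IE 0 (lexx _)).
    by rewrite mul0r sub0r (mgf0 iidS mrX rX0) ln1 oppr0.
  have Ifin : I \is a fin_num by rewrite ge0_fin_numE// (lt_trans Ic)// ltry.
  have := @cramer_lower_bound _ _ _ _ _ P S iidS _ mrX rX0 mgf_rslope_gt0
    mgf_rslope_cvg1 mgf_rslope_derivable x _ c (fine I).
  have h1 y : y < x -> exists2 t, 0 < t & M (- t) < expR (- (t * y)).
    by move=> yx; apply: mgf_rslope_lt; apply: lt_le_trans xm; rewrite lte_fin.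
  have h2 l : l <= 0 -> l * x - ln (M l) <= fine I.
    by move=> l0; rewrite -lee_fin fineK// IE.
  have h3 : fine I < c by rewrite -lte_fin fineK.
  move=> /(_ h1 h2 h3) H.
  near=> K; apply: le_exponent_of_ge; first by near: K.
  rewrite /outage; under eq_set do rewrite lee_fin.
  apply: (@le_trans _ _ (P [set w | (sum_states S (rslope J) K w <= K%:R * x)%R])).
    by near: K.
  apply: (outage_lower iidS J_meas J_noninc J_lim rho_gt0 slope0_fin_ae).
  by near: K.
Unshelve. all: end_near. Qed.

End wideband_exponent.

(** * Wideband minimum energy per nat *)

Section wideband_min_energy.
Context {d d' : measure_display} {Omega : measurableType d}
  {T : measurableType d'} {R : realType} (P : probability Omega R).
Variables (S : nat -> {RV P >-> T}) (iidS : iid S) (J : R -> T -> R).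
Hypothesis J_ge0 : forall (g : R) (s : T), 0 < g -> 0 <= J g s.
Hypothesis J_meas : forall g : R, 0 < g -> measurable_fun [set: T] (J g).
Hypothesis J_noninc : forall (s : T) (g g' : R), 0 < g -> g <= g' -> J g' s / g' <= J g s / g.
Hypothesis J_lim : forall s : T, cvg ((J g s / g)%:E @[g --> 0^'+]).
Hypothesis slope0_fin : {ae P, forall w, slope0 J (S 0 w) \is a fin_num}.
Variable rho : R.
Hypothesis rho_gt0 : 0 < rho.
Local Notation mean := (\int[P]_w slope0 J (S 0 w))%E.
Local Notation M := (mgf S (rslope J)).
Hypothesis M_lt : forall y, (y%:E < mean)%E ->
  exists2 t, 0 < t & M (- t) < expR (- (t * y)).

Lemma rate_ge0 K w : (0 < K)%N -> 0 <= rate J S K rho w.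
Proof. by move=> K0; apply: sumr_ge0 => k _; rewrite J_ge0// divr_gt0 ?ltr0n. Qed.

Lemma measurable_rate K : (0 < K)%N -> measurable_fun setT (rate J S K rho).
Proof.
move=> K0; apply: measurable_sum => k; apply: (measurable_RV_comp S k).
by apply: J_meas; rewrite divr_gt0 ?ltr0n.
Qed.

Lemma mean_rate_le K : (0 < K)%N ->
  (\int[P]_w (rate J S K rho w)%:E <= rho%:E * mean)%E.
Proof.
move=> K0; have g0 : 0 < rho / K%:R by rewrite divr_gt0 ?ltr0n.
have mX : measurable_fun setT (fun w => slope0 J (S 0 w)) by exact: measurable_X.
under eq_integral do rewrite /rate -sumEFin.
rewrite ge0_integral_sum//; last 2 first.
- move=> k; apply/measurable_EFinP.
  by apply: (measurable_RV_comp S k); exact: J_meas.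
- by move=> k w _; rewrite lee_fin J_ge0.
apply: (@le_trans _ _ (\sum_(k < K) ((rho / K%:R)%:E * mean))%E).
  apply: lee_sum => k _.
  rewrite (@iid_integral _ _ _ _ _ P S iidS k (fun s => (J (rho / K%:R) s)%:E)); last 2 first.
  - by apply/measurable_EFinP; exact: J_meas.
  - by move=> s; rewrite lee_fin J_ge0.
  rewrite -ge0_integralZl_EFin//; [|by move=> w _; exact: slope0_ge0|exact: ltW].
  apply: ge0_le_integral => //.
  - by move=> w _; rewrite lee_fin J_ge0.
  - by apply/measurable_EFinP; apply: (measurable_RV_comp S 0); exact: J_meas.
  - by apply: emeasurable_funM.
  - move=> w _; rewrite muleC -lee_pdivrMr//.
    exact: (slope0_ge J_noninc J_lim (S 0 w) g0).
rewrite sumr_const card_ord; set x := (_ * mean)%E.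
apply: (@le_trans _ _ (K%:R%:E * x)%E); first by rewrite mule_natl.
by rewrite /x muleA -EFinM mulrC divfK// pnatr_eq0 -lt0n.
Qed.

Lemma rate_lower_tail y : (y%:E < mean)%E ->
  P [set w | (rate J S K rho w <= rho * y)%R] @[K --> \oo] --> 0%E.
Proof.
move=> ym; have [t t0 Mt] := M_lt ym.
have t0' : - t <= 0 by rewrite oppr_le0 ltW.
(* The midpoint between the Chernoff factor and 1 leaves the strict room that [outage_upper] needs,
   with [c = - ln q]. *)
pose q := (expR (t * y) * M (- t) + 1) / 2.
have q1 : expR (t * y) * M (- t) < 1.
  have := Mt; rewrite -(ltr_pM2l (expR_gt0 (t * y))) -expRD.
  by rewrite addrN expR0.
have M0 : 0 <= M (- t) by exact: mgf_ge0.
have q0 : 0 < q by rewrite divr_gt0// ltr_wpDl// mulr_ge0// expR_ge0.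
have H : expR (- (- t * y)) * M (- t) < expR (- (- ln q)).
  by rewrite opprK lnK ?posrE// mulNr opprK /q; lra.
have := outage_upper iidS J_ge0 J_meas J_noninc J_lim rho_gt0 slope0_fin t0' H.
rewrite opprK lnK ?posrE// => N.
apply: (@squeeze_cvge _ _ _ _ (cst 0%E) _ (fun K => (q ^+ K)%:E)).
- by apply: filterS N => K ->; rewrite measure_ge0.
- exact: cvg_cst.
- apply: cvg_EFin; first exact: nearW.
  apply: cvg_expr; rewrite gtr0_norm// /q; lra.
Qed.

(* Since rate has mean at most rho m, mass cannot sit above rho (m + e) unless
   some sits well below rho m, which the lower tail bound excludes. *)
Lemma rate_upper_tail (m e : R) : mean = m%:E -> 0 < e ->
  P [set w | (rho * (m + e) <= rate J S K rho w)%R] @[K --> \oo] --> 0%E.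
Proof.
move=> Em e0.
have m0 : 0 <= m.
  by rewrite -lee_fin -Em; apply: integral_ge0 => w _; exact: slope0_ge0.
pose B K := [set w | (rho * (m + e) <= rate J S K rho w)%R].
pose q K := fine (P (B K)).
have mB K : (0 < K)%N -> measurable (B K).
  move=> K0; rewrite -[B K]setTI (_ : B K = rate J S K rho @^-1` `[rho * (m + e), +oo[).
    exact: measurable_rate.
  by apply/seteqP; split => w /=; rewrite in_itv /= andbT.
(* Pointwise, [rho m + rho e 1_B <= rate + rho m 1_A + rho delta]. After integration, [rho m]
   cancels against the bound on the mean rate. *)
have key K delta : (0 < K)%N -> 0 < delta ->
    e * q K <= m * fine (P [set w | (rate J S K rho w <= rho * (m - delta))%R]) + delta.
  move=> K0 delta0; set A := [set w | _].
  have mA : measurable A by exact: measurable_rate_le.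
  have PA : P A \is a fin_num by exact: fin_num_measure.
  have PB : P (B K) \is a fin_num by apply: fin_num_measure; exact: mB.
  have H : (\int[P]_w (cst (rho * m)%:E w + (rho * e)%:E * (\1_(B K) w)%:E) <=
      \int[P]_w ((rate J S K rho w)%:E +
        ((rho * m)%:E * (\1_A w)%:E + cst (rho * delta)%:E w)))%E.
    apply: ge0_le_integral => //.
    - by move=> w _; rewrite /= -EFinM -EFinD lee_fin addr_ge0 ?mulr_ge0 ?(ltW rho_gt0) ?(ltW e0).
    - apply: emeasurable_funD => //; apply: emeasurable_funM => //.
      by apply/measurable_EFinP/measurable_indicP; exact: mB.
    - apply: emeasurable_funD; first by apply/measurable_EFinP; exact: measurable_rate.
      apply: emeasurable_funD => //; apply: emeasurable_funM => //.
      exact/measurable_EFinP/measurable_indicP.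
    - move=> w _; rewrite /= -!EFinM -!EFinD lee_fin !indicE.
      have r0 := rate_ge0 w K0.
      have rm : 0 <= rho * m by rewrite mulr_ge0// ltW.
      have rd : 0 < rho * delta by rewrite mulr_gt0.
      have re : 0 < rho * e by rewrite mulr_gt0.
      case: (boolP (w \in A)) => wA; case: (boolP (w \in B K)) => wB.
      + have : (rho * (m + e) <= rate J S K rho w)%R by move: wB; rewrite inE.
        by rewrite /= mulrDr !mulr1; lra.
      + by rewrite /= mulr0 mulr1; lra.
      + have : (rho * (m + e) <= rate J S K rho w)%R by move: wB; rewrite inE.
        by rewrite /= mulrDr mulr1 mulr0; lra.
      + have : (rho * (m - delta) < rate J S K rho w)%R.
          by rewrite ltNge; apply: contra wA; rewrite inE.
        by rewrite /= mulrBr !mulr0; lra.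
  move: H.
  have iI (C : set Omega) : measurable C -> (\int[P]_w (\1_C w)%:E = (fine (P C))%:E)%E.
    by move=> mC; rewrite integral_indic// setIT fineK// fin_num_measure.
  have iC (c : R) : (\int[P]_w (cst c%:E w) = c%:E)%E.
    by rewrite integral_cst// -[RHS]mule1; congr mule; exact: probability_setT.
  have mI (C : set Omega) : measurable C -> measurable_fun setT (fun w => (\1_C w : R)%:E).
    by move=> mC; apply/measurable_EFinP; exact/measurable_indicP.
  have mIM (c : R) (C : set Omega) : measurable C -> measurable_fun setT (fun w => c%:E * (\1_C w : R)%:E)%E.
    by move=> mC; apply: emeasurable_funM => //; exact: mI.
  have nnM (c : R) (C : set Omega) w : 0 <= c -> (0 <= c%:E * (\1_C w : R)%:E)%E.
    by move=> c0; rewrite -EFinM lee_fin mulr_ge0.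
  have rm0 : 0 <= rho * m by rewrite mulr_ge0// ltW.
  have re0 : 0 <= rho * e by rewrite mulr_ge0// ltW.
  have rd0 : 0 <= rho * delta by rewrite mulr_ge0// ltW.
  rewrite ge0_integralD; [| exact: measurableT | by move=> w _; rewrite lee_fin
    | exact: measurable_cst | by move=> w _; exact: nnM | by apply: mIM; exact: mB].
  rewrite [leRHS]ge0_integralD; [| exact: measurableT
    | by move=> w _; rewrite lee_fin rate_ge0
    | by apply/measurable_EFinP; exact: measurable_rate
    | by move=> w _; apply: adde_ge0; [exact: nnM|rewrite lee_fin]
    | by apply: emeasurable_funD; [exact: mIM|exact: measurable_cst]].
  rewrite [X in (_ <= _ + X)%E]ge0_integralD; [| exact: measurableT
    | by move=> w _; exact: nnM | exact: mIM
    | by move=> w _; rewrite lee_fin | exact: measurable_cst].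
  rewrite !ge0_integralZl_EFin//; [|exact: mI|by apply: mI; exact: mB].
  rewrite !iC !iI//; last exact: mB.
  move=> /le_trans /(_ (leeD2r _ (mean_rate_le K0))).
  rewrite Em -!EFinM -!EFinD lee_fin -/(q K) => H.
  rewrite -(ler_pM2l rho_gt0) mulrDr !mulrA; lra.
suff C : q K @[K --> \oo] --> (0 : R).
  apply/fine_cvgP; split => //; exists 1%N => // K K0.
  by apply: fin_num_measure; exact: mB.
apply/cvgrPdist_le => eps eps0.
(* One half of [e * eps] covers the additive [delta], the other the vanishing lower tail term. *)
pose delta := e * eps / 2.
have delta0 : 0 < delta by rewrite divr_gt0// mulr_gt0.
have Ed : e * eps = delta + delta by rewrite /delta -splitr.
have [|_ L] := (fine_cvgP _ 0).1 (@rate_lower_tail (m - delta) _).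
  by rewrite Em lte_fin gtrBl.
have L' : m * fine (P [set w | (rate J S K rho w <= rho * (m - delta))%R])
    @[K --> \oo] --> m * 0.
  by apply: cvgM; [exact: cvg_cst|exact: L].
rewrite mulr0 in L'.
have N := cvgr_lt _ L' _ delta0.
have Kpos : \forall K \near \oo, (0 < K)%N by exists 1%N.
near=> K.
have K0 : (0 < K)%N by near: K.
rewrite sub0r normrN ger0_norm ?fine_ge0//.
have h1 := key K delta K0 delta0.
have h2 : m * fine (P [set w | (rate J S K rho w <= rho * (m - delta))%R]) < delta.
  by near: K; exact: N.
rewrite -(ler_pM2l e0) Ed.
by apply: le_trans h1 _; lra.
Unshelve. all: end_near. Qed.

(** The map [r |-> rho / r] is continuous away from 0, so the preimage of [U] there is open; the
    single point 0 is added separately. *)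
Lemma measurable_rate_open K (U : set (\bar R)) : (0 < K)%N -> open U ->
  measurable [set w | ~ U (rho%:E / (rate J S K rho w)%:E)%E].
Proof.
move=> K0 oU; pose V := [set r : R | U (rho%:E / r%:E)%E].
suff mV : measurable V.
  rewrite -[X in measurable X]setTI
    (_ : [set w | _] = rate J S K rho @^-1` (~` V))//.
  by apply: measurable_rate => //; exact: measurableC.
have -> : V = (V `&` [set r | r != 0]) `|` (V `&` [set 0]).
  apply/seteqP; split => [r Vr|r [[]|[]]//].
  have [r0|r0] := eqVneq r 0; first by right; split.
  by left; split.
apply: measurableU; last first.
  have [V0|V0] := pselect (V 0).
    rewrite (_ : _ `&` _ = [set 0]); first exact: measurable_set1.
    by apply/seteqP; split => [r []//|r ->].
  rewrite (_ : _ `&` _ = set0); first exact: measurable0.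
  by apply/seteqP; split => [r [Vr /= r0]|//]; apply: V0; rewrite -r0.
apply: open_measurable; rewrite openE => r [Vr /= r0].
rewrite /interior /=.
have C : (rho / s)%:E @[s --> r] --> (rho / r)%:E.
  apply: cvg_EFin; first exact: nearW.
  by apply: cvgM; [exact: cvg_cst|apply: cvgV => //; exact: cvg_id].
have U1 : nbhs (rho / r)%:E U.
  apply: open_nbhs_nbhs; split => //.
  by move: Vr; rewrite /V /= inver (negbTE r0) -EFinM.
have N0 : \forall s \near r, s != 0.
  by apply: (open_nbhs_nbhs (A := [set s | s != 0])); split => //; exact: open_neq.
have := C _ U1; rewrite /= => N1.
near=> s; have s0 : s != 0 by near: s.
split => //; rewrite /V /= inver (negbTE s0) -EFinM.
by near: s.
Unshelve. all: end_near. Qed.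

Lemma rate_inv K w : (rho%:E / (rate J S K rho w)%:E)%E =
  ((rate J S K rho w / rho)%:E^-1)%E.
Proof.
have rn0 : rho != 0 by rewrite gt_eqF.
rewrite !inver mulf_eq0 invr_eq0 (negbTE rn0) orbF.
case: ifPn => r0; first by rewrite gt0_muley ?lte_fin.
by rewrite -EFinM invf_div.
Qed.

Let outside (U : set (\bar R)) K := [set w | ~ U (rho%:E / (rate J S K rho w)%:E)%E].

(** Outside the two tail events [rate / rho] lies in []y, m + e[], where its inverse is in [U]. A
    negative [y] is allowed, which is how mean 0 is covered. *)
Lemma cvg_outside_of_finite_mean (U : set (\bar R)) (m y e : R) :
  open U -> mean = m%:E -> y < m -> 0 < e ->
  (forall a : R, 0 <= a -> y < a -> a < m + e -> U (a%:E^-1)%E) ->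
  P (outside U K) @[K --> \oo] --> 0%E.
Proof.
move=> oU Em ym e0 HU.
have ym' : (y%:E < mean)%E by rewrite Em lte_fin.
have C : (P [set w | (rate J S K rho w <= rho * y)%R] +
    P [set w | (rho * (m + e) <= rate J S K rho w)%R])%E @[K --> \oo] --> 0%E.
  rewrite -[X in _ --> X]adde0.
  by apply: cvgeD => //; [exact: rate_lower_tail|exact: rate_upper_tail].
apply: (squeeze_cvge _ (cvg_cst 0%E) C).
exists 1%N => // K /= K0; rewrite measure_ge0 /=.
have mB : measurable [set w | (rho * (m + e) <= rate J S K rho w)%R].
  rewrite -[X in measurable X]setTI
    (_ : [set w | _] = rate J S K rho @^-1` `[rho * (m + e), +oo[).
    exact: measurable_rate.
  by apply/seteqP; split => w /=; rewrite in_itv /= andbT.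
have mA := measurable_rate_le S J_meas rho_gt0 y K0.
apply: le_trans (measureU2 _ mA mB).
apply: le_measure; rewrite ?inE.
- exact: measurable_rate_open.
- exact: measurableU.
- move=> w /= nU; apply: contrapT => /not_orP[/negP h1 /negP h2]; apply: nU.
  rewrite rate_inv; apply: HU.
  + by rewrite divr_ge0 ?rate_ge0// ltW.
  + by rewrite ltr_pdivlMr// mulrC ltNge.
  + by rewrite ltr_pdivrMr// mulrC ltNge.
Qed.

Lemma cvg_outside_of_infinite_mean (U : set (\bar R)) (y : R) :
  open U -> mean = +oo%E -> 
  (forall a : R, 0 <= a -> y < a -> U (a%:E^-1)%E) ->
  P (outside U K) @[K --> \oo] --> 0%E.
Proof.
move=> oU Em HU.
have ym' : (y%:E < mean)%E by rewrite Em ltry.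
apply: (squeeze_cvge _ (cvg_cst 0%E) (rate_lower_tail ym')).
exists 1%N => // K /= K0; rewrite measure_ge0 /=.
apply: le_measure; rewrite ?inE.
- exact: measurable_rate_open.
- exact: measurable_rate_le.
- move=> w /= nU; apply: contrapT => /negP h1; apply: nU.
  rewrite rate_inv; apply: HU; first by rewrite divr_ge0 ?rate_ge0// ltW.
  by rewrite ltr_pdivlMr// mulrC ltNge.
Qed.

Lemma wideband_min_energy : is_wideband_min_energy_per_nat J S rho (mean^-1)%E.
Proof.
move=> U oU Um; rewrite -/(outside U).
have nU : nbhs (mean^-1)%E U by exact: open_nbhs_nbhs.
have mean0 : (0 <= mean)%E by apply: integral_ge0 => w _; exact: slope0_ge0.
case Em : mean mean0 nU => [m| |//] mean0; last first.
  rewrite invey => nU; have /nbhs_ballP[r /= r0 Hr] : nbhs (0 : R) (fun a => U a%:E) by [].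
  apply: (@cvg_outside_of_infinite_mean U r^-1) => // a a0 ra.
  have ap : 0 < a by apply: lt_trans ra; rewrite invr_gt0.
  rewrite inver gt_eqF//; apply: Hr.
  rewrite /ball /= sub0r normrN gtr0_norm ?invr_gt0//.
  by rewrite -[r]invrK ltf_pV2 ?posrE// invr_gt0.
(* For mean 0 the limit is [+oo]: the lower tail is void with [y = - 1], and [a < 1 / z'] puts
   [1 / a] above [z]. *)
have [m0|m0] := eqVneq m 0.
  rewrite m0 inve0 => -[z [zr Hz]].
  pose z' := Num.max z 1.
  have z'0 : 0 < z' by rewrite lt_max ltr01 orbT.
  apply: (@cvg_outside_of_finite_mean U m (- 1) z'^-1) => //.
  - by rewrite m0 ltrN10.
  - by rewrite invr_gt0.
  - move=> a a0 _; rewrite m0 add0r => az; apply: Hz.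
    rewrite inver; case: eqVneq => [_|an0]; first by rewrite ltry.
    have ap : 0 < a by rewrite lt_neqAle eq_sym an0.
    rewrite lte_fin; apply: (@le_lt_trans _ _ z'); first by rewrite le_max lexx.
    by rewrite -[z']invrK ltf_pV2 ?posrE// invr_gt0.
rewrite inver (negbTE m0) => nU.
have C : (a^-1)%:E @[a --> m] --> (m^-1)%:E.
  by apply: cvg_EFin; [exact: nearW|apply: cvgV => //; exact: cvg_id].
have mp : 0 < m by rewrite lt_neqAle eq_sym m0 -lee_fin.
have /nbhs_ballP[r /= r0 Hr] := C _ nU.
(* The maximum with 0 keeps [a] positive as well as within [r] of [m]. *)
apply: (@cvg_outside_of_finite_mean U m (Num.max 0 (m - r)) r) => //.
- by rewrite gt_max mp gtrBl.
- move=> a a0; rewrite gt_max => /andP[ap am] ar.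
  rewrite inver gt_eqF//; apply: Hr; rewrite /ball /= ltr_distlC; lra.
Qed.

End wideband_min_energy.

Unset Implicit Arguments.

Theorem proposition1 (R : realType) (d d' : measure_display)
    (Omega : measurableType d) (T : measurableType d')
    (P : probability Omega R) (S : nat -> {RV P >-> T}) (J : R -> T -> R)
    (iidS : iid S)
    (J_ge0 : forall (g : R) (s : T), 0 < g -> 0 <= J g s)
    (J_meas : forall g : R, 0 < g -> measurable_fun [set: T] (J g))
    (J_noninc : forall (s : T) (g g' : R), 0 < g -> g <= g' -> J g' s / g' <= J g s / g)
    (J_lim : forall s : T, cvg ((J g s / g)%:E @[g --> 0^'+]))
    (Lambda := log_mgf P (fun w => slope0 J (S 0%N w)))
    (Lambda_smooth : essentially_smooth Lambda)
    (Lambda_lsc : lower_semicontinuous Lambda)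
    (eta_bar := ((\int[P]_w slope0 J (S 0%N w))^-1)%E)
    (rho : R) (rho_gt0 : 0 < rho) :
  is_wideband_min_energy_per_nat J S rho eta_bar /\
  forall eta : \bar R, (eta_bar <= eta)%E ->
    is_wideband_outage_exponent J S rho eta
      (ereal_sup [set (l%:E / eta - Lambda l)%E | l in [set l : R | l <= 0]]).
Proof.
have [LgtNy _ _ Lder _] := Lambda_smooth.
have fin_ae := slope0_fin_ae J_ge0 J_meas J_noninc J_lim Lambda_lsc.
have M_lt := mgf_rslope_lt iidS J_ge0 J_meas J_noninc J_lim Lambda_lsc.
have expo := outage_exponent iidS J_ge0 J_meas J_noninc J_lim LgtNy Lder Lambda_lsc rho_gt0.
split; first exact: wideband_min_energy.
have mean0 : (0 <= \int[P]_w slope0 J (S 0%N w))%E.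
  by apply: integral_ge0 => w _; exact: slope0_ge0.
have finite_case (eta : \bar R) (x : R) : (eta^-1 = x%:E)%E ->
    (x%:E <= \int[P]_w slope0 J (S 0%N w))%E ->
    is_wideband_outage_exponent J S rho eta
      (ereal_sup [set (l%:E / eta - Lambda l)%E | l in [set l : R | l <= 0]]).
  by move=> Ex xm; rewrite /is_wideband_outage_exponent Ex -EFinM; exact: expo.
move=> eta; rewrite /eta_bar; case: eta => [eta| |].
(* For [eta = 0] the target rate is [+oo] and outage is certain, so the exponent is 0. The supremum
   agrees: [l / 0 = -oo] for [l < 0], and [l = 0] contributes 0. *)
- have [->|eta0] := eqVneq eta 0.
    move=> _; rewrite /is_wideband_outage_exponent inve0 gt0_muley ?lte_fin//.
    rewrite (_ : ereal_sup _ = 0%E).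
      apply: cvg_near_cst; apply: nearW => K.
      rewrite /outage; under eq_set do rewrite leey.
      rewrite (_ : P _ = 1%E) ?lne1 ?oppe0 ?mul0e//.
      rewrite (_ : [set w | _] = setT); first exact: probability_setT.
      by apply/seteqP; split.
    have L0 : Lambda 0 = 0%E by exact: log_mgf0.
    apply/eqP; rewrite eq_le; apply/andP; split.
      apply: ge_ereal_sup => _ [l /= l0 <-].
      have [->|ln0] := eqVneq l 0; first by rewrite mul0e L0 sube0.
      have {}l0 : l < 0 by rewrite lt_neqAle ln0.
      by rewrite lt0_muley ?lte_fin// addNye leNye.
    by apply: ereal_sup_ubound; exists 0 => //=; rewrite mul0e L0 sube0.
  move=> le_eta; apply: (finite_case _ eta^-1); first by rewrite inver (negbTE eta0).
  (* Inverting [eta_bar <= eta] gives [1 / eta <= mean]. Mean 0 is impossible here, as [eta_bar]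
     would be [+oo]. *)
  move: le_eta mean0; case: (\int[P]_w _)%E => [m| |]//; last by move=> *; rewrite leey.
  rewrite inver !lee_fin; case: ifPn => // m0; rewrite lee_fin => le_eta mge0.
  have mp : 0 < m by rewrite lt_neqAle eq_sym m0.
  have mV : 0 < m^-1 by rewrite invr_gt0.
  by rewrite -[m]invrK lef_pV2 ?posrE// (lt_le_trans mV).
(* For [eta = +oo] the target rate is 0. *)
- by move=> _; apply: (finite_case _ 0).
(* The value [eta = -oo] contradicts [eta_bar <= eta], since [eta_bar] is finite or [+oo]. *)
- move: mean0; case: (\int[P]_w _)%E => [m| |]// mge0; rewrite ?inver ?invey//.
  by case: ifPn.
Qed.
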